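(* Let $X$ be a real Banach space whose dual $X^*$ is isometrically isomorphic to $\ell_1$. For every $\alpha\in\ell_1$ with $\|\alpha\|<r^*(X)$, there exists a closed subspace of $X$ which is isometric to $W_\alpha$ and complemented in $X$.
   Context: All spaces are real. A closed subspace $Y\subseteq X$ is complemented if there is a bounded linear projection of $X$ onto $Y$. $B_Z$ is the closed unit ball of $Z$, $\operatorname{ext} K$ is the set of extreme points of a convex set $K$; for $A\subseteq X^*$, $A'$ denotes the set of $\sigma(X^*,X)$-cluster points (weak*-accumulation points) of the set $A$. $r^*(X):=\sup\{\|g^*\| : g^*\in(\operatorname{ext} B_{X^*})'\}$ (so $r^*(X)\le 1$). Let $c$ be the space of convergent real sequences with the sup norm. For $\alpha\in B_{\ell_1}$, $W_\alpha$ is the closed subspace (with sup norm) $W_\alpha=\{x\in c:\ \lim_{i\to\infty}x(i)=\sum_{i=1}^\infty \alpha(i)x(i)\}$. *)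

(* Defs.v *)
From HB Require Import structures.
From mathcomp Require Import all_boot all_order all_algebra.
From mathcomp Require Import all_classical all_reals all_analysis.

Set Implicit Arguments.
Unset Strict Implicit.
Unset Printing Implicit Defensive.

Import Order.TTheory GRing.Theory Num.Theory.
Import numFieldNormedType.Exports.

Local Open Scope classical_set_scope.
Local Open Scope ring_scope.

(* The supremum is the genuine one only for [f] bounded on a nonempty [A]. *)
Definition supnorm (R : realType) (T : Type) (A : set T) (f : T -> R) : R :=
  sup [set `|f t| | t in A].

Definition bounded_on (R : realType) (T : Type) (A : set T) (f : T -> R) :=
  exists M, forall t, A t -> `|f t| <= M.

Section supnorm_theory.
Context {R : realType} {T : Type}.
Variable A : set T.
Hypothesis A0 : A !=set0.

Lemma supnorm_ub (f : T -> R) t : bounded_on A f -> A t -> `|f t| <= supnorm A f.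
Proof.
move=> [M fM] At; apply: ub_le_sup; last by exists t.
by exists M => _ [s As <-]; exact: fM.
Qed.

Lemma supnorm_le (f : T -> R) M : (forall t, A t -> `|f t| <= M) -> supnorm A f <= M.
Proof.
move=> fM; apply: ge_sup; first by case: A0 => t At; exists `|f t|, t.
by move=> _ [s As <-]; exact: fM.
Qed.

Lemma supnormD (f g : T -> R) : bounded_on A f -> bounded_on A g ->
  supnorm A (fun t => f t + g t) <= supnorm A f + supnorm A g.
Proof.
move=> bf bg; apply: supnorm_le => t At.
by rewrite (le_trans (ler_normD _ _))// lerD ?supnorm_ub.
Qed.

Lemma supnormZ (f : T -> R) (l : R) : bounded_on A f ->
  supnorm A (fun t => l * f t) = `|l| * supnorm A f.
Proof.
move=> bf; have le (h : T -> R) k : bounded_on A h ->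
    supnorm A (fun t => k * h t) <= `|k| * supnorm A h.
  by move=> bh; apply: supnorm_le => t At; rewrite normrM ler_wpM2l ?supnorm_ub.
apply/eqP; rewrite eq_le le//=.
have [->|l0] := eqVneq l 0.
  rewrite normr0 mul0r; case: A0 => t At.
  apply: le_trans (supnorm_ub _ At); first exact: normr_ge0.
  by exists 0 => s _; rewrite mul0r normr0.
have blf : bounded_on A (fun t => l * f t).
  by case: bf => M fM; exists (`|l| * M) => t At; rewrite normrM ler_wpM2l ?fM.
rewrite -ler_pdivlMl ?normr_gt0// -normfV.
have := le _ l^-1 blf; congr (_ <= _); congr supnorm.
by apply/funext => t; rewrite mulKf.
Qed.

Lemma supnorm_eq0 (f : T -> R) : bounded_on A f -> supnorm A f = 0 ->
  forall t, A t -> f t = 0.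
Proof.
move=> bf f0 t At; apply/eqP; rewrite -normr_le0 -f0.
exact: supnorm_ub.
Qed.

End supnorm_theory.

Section convergent_sequences.
Variable R : realType.

Definition in_cvgseq : {pred nat -> R^o} := [pred x : nat -> R^o | `[< cvgn x >]].

Record cvgseq := CvgSeq { cvgseq_val :> nat -> R^o ; _ : cvgseq_val \in in_cvgseq }.

HB.instance Definition _ := [isSub for cvgseq_val].
HB.instance Definition _ := [Choice of cvgseq by <:].

Lemma cvgseqP (x : cvgseq) : cvgn x.
Proof. by case: x => x /= /asboolP. Qed.
Arguments cvgseqP : clear implicits.

Lemma in_cvgseq_submod_closed : submod_closed in_cvgseq.
Proof.
split; first by apply/asboolP; exact: is_cvg_cst.
move=> a x y /asboolP cx /asboolP cy; apply/asboolP.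
by apply: is_cvgD => //; exact: is_cvgZr.
Qed.
HB.instance Definition _ :=
  GRing.isSubmodClosed.Build R (nat -> R^o) in_cvgseq in_cvgseq_submod_closed.
HB.instance Definition _ := [SubChoice_isSubLmodule of cvgseq by <:].

Definition cvgseq_norm (x : cvgseq) : R := supnorm [set: nat] x.

Lemma cvgseq_bounded (x : cvgseq) : bounded_on [set: nat] (x : nat -> R).
Proof.
have /cvg_seq_bounded[M [_ xM]] := cvgseqP x.
by exists (M + 1) => n _; apply: xM => //; rewrite ltrDl.
Qed.

Let cvgseq_normD x y : cvgseq_norm (x + y) <= cvgseq_norm x + cvgseq_norm y.
Proof. by apply: supnormD; [exists 0%N|exact: cvgseq_bounded..]. Qed.

Let cvgseq_normZ (l : R) x : cvgseq_norm (l *: x) = `|l| * cvgseq_norm x.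
Proof. by apply: supnormZ; [exists 0%N|exact: cvgseq_bounded]. Qed.

Let cvgseq_norm0_eq0 x : cvgseq_norm x = 0 -> x = 0.
Proof.
move=> x0; apply/val_inj/funext => n.
exact: (supnorm_eq0 (cvgseq_bounded x) x0).
Qed.

HB.instance Definition _ := Lmodule_isNormed.Build R cvgseq
  cvgseq_normD cvgseq_normZ cvgseq_norm0_eq0.

End convergent_sequences.
Arguments cvgseqP {R} x.

Section summable_sequences.
Variable R : realType.

Definition in_ell1 : {pred nat -> R^o} :=
  [pred a : nat -> R^o | `[< cvgn [series `|a n|]_n >]].

Record ell1 := Ell1 { ell1_val :> nat -> R^o ; _ : ell1_val \in in_ell1 }.

HB.instance Definition _ := [isSub for ell1_val].
HB.instance Definition _ := [Choice of ell1 by <:].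

Lemma ell1P (a : ell1) : cvgn [series `|a n|]_n.
Proof. by case: a => a /= /asboolP. Qed.
Arguments ell1P : clear implicits.

Let cvg_normedZ (l : R) (a : nat -> R^o) :
  cvgn [series `|a n|]_n -> cvgn [series `|(l *: a) n|]_n.
Proof.
move=> ca; rewrite (_ : [series _]_n = series (`|l| *: [sequence `|a n|]_n)).
  exact: is_cvg_seriesZ.
by congr series; apply/funext => n /=; rewrite normrZ.
Qed.

Let cvg_normedD (a b : nat -> R^o) :
  cvgn [series `|a n|]_n -> cvgn [series `|b n|]_n ->
  cvgn [series `|(a + b) n|]_n.
Proof.
move=> ca cb; apply: series_le_cvg (is_cvg_seriesD ca cb) => n /=.
- exact: normr_ge0.
- by rewrite addr_ge0.
- exact: ler_normD.
Qed.

Lemma in_ell1_submod_closed : submod_closed in_ell1.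
Proof.
split.
  apply/asboolP; rewrite (_ : [series _]_n = cst 0); first exact: is_cvg_cst.
  by apply/funext => n; rewrite /series/= big1// => i _; exact: normr0.
move=> l a b /asboolP ca /asboolP cb; apply/asboolP.
by apply: cvg_normedD => //; exact: cvg_normedZ.
Qed.
HB.instance Definition _ :=
  GRing.isSubmodClosed.Build R (nat -> R^o) in_ell1 in_ell1_submod_closed.
HB.instance Definition _ := [SubChoice_isSubLmodule of ell1 by <:].

Definition ell1_norm (a : ell1) : R := limn [series `|a n|]_n.

Let ell1_normD a b : ell1_norm (a + b) <= ell1_norm a + ell1_norm b.
Proof.
rewrite /ell1_norm -(lim_seriesD (ell1P a) (ell1P b)).
apply: lim_series_le; [exact: (ell1P (a + b))| |].
  exact: (is_cvg_seriesD (ell1P a) (ell1P b)).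
by move=> n; exact: ler_normD.
Qed.

Let ell1_normZ (l : R) a : ell1_norm (l *: a) = `|l| * ell1_norm a.
Proof.
rewrite /ell1_norm -[RHS](lim_seriesZ `|l| (ell1P a)); congr (limn (series _)).
by apply/funext => n /=; exact: normrM.
Qed.

Let ell1_norm0_eq0 a : ell1_norm a = 0 -> a = 0.
Proof.
move=> a0; apply/val_inj/funext => n /=; apply/eqP; rewrite -normr_le0 -a0.
apply: le_trans (nondecreasing_cvgn_le _ (ell1P a) n.+1).
  by rewrite /series/= big_nat_recr//= lerDr sumr_ge0.
by apply/nondecreasing_seqP => k; rewrite /series/= big_nat_recr//= lerDl.
Qed.

HB.instance Definition _ := Lmodule_isNormed.Build R ell1
  ell1_normD ell1_normZ ell1_norm0_eq0.

End summable_sequences.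
Arguments ell1P {R} a.

Definition unit_ball (R : realType) (V : normedModType R) : set V :=
  [set x | `|x| <= 1].
Arguments unit_ball {R} V.

Section dual_space.
Context {R : realType}.
Variable X : normedModType R.

Definition in_dual : {pred X -> R^o} :=
  [pred f : X -> R^o | `[< linear f /\ continuous f >]].

Record dual := Dual { dual_val :> X -> R^o ; _ : dual_val \in in_dual }.

HB.instance Definition _ := [isSub for dual_val].
HB.instance Definition _ := [Choice of dual by <:].

Lemma dualP (f : dual) : linear f /\ continuous f.
Proof. by case: f => f /= /asboolP. Qed.

Lemma in_dual_submod_closed : submod_closed in_dual.
Proof.
split.
  apply/asboolP; split; last by move=> x; exact: cvg_cst.
  by move=> a x y; rewrite scaler0 addr0.
move=> a f g /asboolP[lf cf] /asboolP[lg cg]; apply/asboolP; split.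
  move=> b x y; rewrite !fctE /= lf lg !scalerDr !scalerA [b * a]mulrC.
  by rewrite -!addrA; congr (_ + _); rewrite addrCA.
by move=> x; apply: cvgD; [apply: cvgZr; exact: cf|exact: cg].
Qed.
HB.instance Definition _ :=
  GRing.isSubmodClosed.Build R (X -> R^o) in_dual in_dual_submod_closed.
HB.instance Definition _ := [SubChoice_isSubLmodule of dual by <:].

Definition dual_norm (f : dual) : R := supnorm (unit_ball X) f.

Let unit_ball0 : unit_ball X !=set0.
Proof. by exists 0; rewrite /unit_ball/= normr0. Qed.

Lemma dual_bounded (f : dual) : bounded_on (unit_ball X) (f : X -> R).
Proof.
case: (dualP f) => lf cf.
pose lin := GRing.isLinear.Build R X R^o *:%R f lf.
pose g : {linear X -> R^o} := HB.pack (f : X -> R^o) lin.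
have /linear_bounded_continuous/linear_boundedP : continuous g by exact: cf.
move=> /pinfty_ex_gt0[M M0 gM]; exists M => x x1.
by rewrite (le_trans (gM x))// ler_piMr// ltW.
Qed.

Let dual_normD f g : dual_norm (f + g) <= dual_norm f + dual_norm g.
Proof. by apply: supnormD; [|exact: dual_bounded..]. Qed.

Let dual_normZ (l : R) f : dual_norm (l *: f) = `|l| * dual_norm f.
Proof. by apply: supnormZ; [|exact: dual_bounded]. Qed.

Let dual_norm0_eq0 f : dual_norm f = 0 -> f = 0.
Proof.
move=> f0; apply/val_inj/funext => x /=.
have [lf _] := dualP f.
have f00 : f 0 = 0.
  by apply: (supnorm_eq0 (dual_bounded f) f0); rewrite /unit_ball/= normr0.
have [->|x0] := eqVneq x 0; first exact: f00.
have xN : `|x| != 0 by rewrite normr_eq0.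
have fs : f (`|x|^-1 *: x) = 0.
  apply: (supnorm_eq0 (dual_bounded f) f0).
  by rewrite /unit_ball/= normrZ normfV normr_id mulVf.
have := lf `|x|^-1 x 0; rewrite addr0 fs f00 addr0 => /esym/eqP.
by rewrite scaler_eq0 invr_eq0 (negbTE xN) => /eqP.
Qed.

HB.instance Definition _ := Lmodule_isNormed.Build R dual
  dual_normD dual_normZ dual_norm0_eq0.

(* [dual] carries the norm topology; this copy of it carries sigma(X^*, X),
   the topology of pointwise convergence on [X]. *)
Definition weak_star_dual :=
  initial_topology (fun f : dual => (f : {ptws X -> R^o})).

End dual_space.

Definition extreme_points (R : realType) (V : lmodType R) (K : set V) : set V :=
  [set x | K x /\ forall y z (t : R), K y -> K z -> 0 < t < 1 ->
     x = t *: y + (1 - t) *: z -> y = x /\ z = x].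

(* A point of the derived set need not belong to the set, and the set's own
   isolated points are excluded: this is [limit_point], not [closure]. *)
Definition weak_star_derived (R : realType) (X : normedModType R)
    (A : set (dual X)) : set (dual X) :=
  limit_point (A : set (weak_star_dual X)).

(* If the derived set is empty (e.g. when [X] is finite-dimensional) this is
   [0]; when [dual X] is isometric to [ell1] it is a nonempty bounded sup. *)
Definition rstar (R : realType) (X : normedModType R) : R :=
  sup [set `|g| | g in weak_star_derived (extreme_points (unit_ball (dual X)))].

(* Linear isometry of the linear subspace [A] onto [B]; the values of [f]
   outside [A] are irrelevant. *)
Definition linearly_isometric (R : realType) (U V : normedModType R)
    (A : set U) (B : set V) : Prop :=
  exists f : U -> V, [/\ set_bij A B f,
    forall (a : R) x y, A x -> A y -> f (a *: x + y) = a *: f x + f y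
    & forall x, A x -> `|f x| = `|x|].

Definition closed_subspace (R : realType) (X : normedModType R) (Y : set X) :=
  submod_closed [in Y] /\ closed Y.

Definition complemented (R : realType) (X : normedModType R) (Y : set X) :=
  exists P : {linear X -> X},
    [/\ bounded_near P (nbhs (0 : X)), P \o P = P & range P = Y].

Definition Wspace (R : realType) (alpha : ell1 R) : set (cvgseq R) :=
  [set x : cvgseq R | limn x = limn (series (fun i => alpha i * x i))].

(* Main.v *)
Require Import Defs.
From HB Require Import structures.
From mathcomp Require Import all_boot all_order all_algebra.
From mathcomp Require Import all_classical all_reals all_analysis.
From mathcomp Require Import ring lra.
Set Implicit Arguments.
Unset Strict Implicit.
Unset Printing Implicit Defensive.
Import Order.TTheory GRing.Theory Num.Theory.
Import numFieldNormedType.Exports.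
Local Open Scope classical_set_scope.
Local Open Scope ring_scope.

(** Let (e_j) be the basis of X^* = ell_1. Some weak* cluster point g of the
extreme points +-e_j has norm larger than alpha, and X is separable, so (after
changing signs) a subsequence (e_{m_k}) converges weak* to g. Write g = sum_j g_j e_j. For
large N_0 and m_k >= N_0, beta := (alpha_k - g_{m_k})_k still has norm less than
G := sum_(j < N_0) |g_j|. It suffices to lift W_alpha isometrically along
x |-> (e_{m_k}(x))_k : X -> c, since a hyperplane of c is complemented.

The lift is the closed span of nested copies E_n of ell_infty^n, with bases
(x_i)_{i<n} satisfying e_{m_k}(x_i) = delta_ik for k < n,
sum_i |e_j(x_i)| <= 1 for all j, and (g - sum_k alpha_k e_{m_k})(x_i) = 0.
To pass from E_n to E_{n+1} one needs a vector v with e_{m_k}(v) = delta_kn for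
k <= n, replacing x_i by x_i - e_{m_n}(x_i) v. The constraints on v are membership in
finitely many balls and finitely many linear equations. They have an obvious
solution in X^** = ell_infty, where the strict inequality |beta| < G leaves
room at the coordinates j < N_0, and a solution in the bidual yields an exact one
in X, by Hahn-Banach and successive approximation. That the E_n exhaust W_alpha follows from
Hahn-Banach again. *)

(** * Hahn-Banach *)

(** The sequence [(e_{m_k}(x))_k] converges to [g(x)], so it lies in [W_alpha] exactly when
    [h := g - sum_k alpha_k e_{m_k}] vanishes at [x]. An element [U] of the bidual with
    [U(e_{m_k}) = delta_kn], and 0 at the other coordinates from [N_0] on, has [U(h) = sum_(j < N_0)
    g_j U(e_j) + g_{m_n} - alpha_n], which is 0 when the sum equals [beta_n]. The cheapest choice is
    [U(e_j) = sg(g_j) beta_n / G]. All vectors together then put about [|beta| / G < 1] on each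
    coordinate [j < N_0], where 1 is allowed; hence [beta], [G] and the strict inequality. The slack
    [1 - |beta| / G] serves twice: the errors made in passing from the bidual to X accumulate inside
    it, and varying [U] inside it gives [h] both signs, so that the equation [h(v) = 0] can be
    repaired without leaving the balls. *)

Section hahn_banach.
Context {R : realType}.

(** Homogeneity is asked for as an inequality only, the form in which infima satisfy it;
    [sublinearZ] recovers equality by scaling back with [t^-1]. *)
Definition sublinear (V : lmodType R) (p : V -> R) :=
  (forall x y, p (x + y) <= p x + p y) /\
  (forall t x, 0 <= t -> p (t *: x) <= t * p x).

Lemma sublinearZ (V : lmodType R) (p : V -> R) t x :
  sublinear p -> 0 <= t -> p (t *: x) = t * p x.
Proof.
move=> [pD pZ]; rewrite le_eqVlt => /predU1P[<-|t0].
  rewrite scale0r mul0r; apply/eqP; rewrite eq_le; apply/andP; split.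
    by have := pZ 0 0 (lexx _); rewrite scale0r mul0r.
  by have := pD 0 0; rewrite addr0 -subr_ge0 addrK.
apply/eqP; rewrite eq_le (pZ _ _ (ltW t0))/=.
have := pZ t^-1 (t *: x); rewrite invr_ge0 (ltW t0) => /(_ isT).
rewrite scalerA mulVf ?gt_eqF// scale1r. by rewrite ler_pdivlMl.
Qed.

Lemma sublinear0 (V : lmodType R) (p : V -> R) : sublinear p -> p 0 = 0.
Proof. by move=> ps; rewrite -(scale0r 0) sublinearZ// mul0r. Qed.

Lemma sublinear_geN (V : lmodType R) (p : V -> R) x :
  sublinear p -> - p (- x) <= p x.
Proof.
by move=> ps; have := ps.1 x (- x); rewrite subrr sublinear0// => ?; lra.
Qed.

(** The modification of [p] that is linear along [y]: the term [t = 0] keeps it below [p], and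
    [t = 1] at [- y] gives [shear p y (- y) <= - p y]. *)
Definition shear (V : lmodType R) (p : V -> R) (y x : V) :=
  inf [set p (x + t *: y) - t * p y | t in [set t | 0 <= t]].

Section shear.
Context {V : lmodType R} {p : V -> R} (ps : sublinear p) (y : V).

Let lbs x : has_lbound [set p (x + t *: y) - t * p y | t in [set t | 0 <= t]].
Proof.
exists (- p (- x)) => _ [t /= t0 <-].
have := ps.1 (x + t *: y) (- x); rewrite addrAC subrr add0r sublinearZ//; lra.
Qed.

Let nes x : [set p (x + t *: y) - t * p y | t in [set t | 0 <= t]] !=set0.
Proof. by eexists; exists 0 => //=. Qed.

Lemma shear_le x t : 0 <= t -> shear p y x <= p (x + t *: y) - t * p y.
Proof. by move=> t0; apply: ge_inf; [exact: lbs|exists t]. Qed.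

Lemma shear_ge x m : (forall t, 0 <= t -> m <= p (x + t *: y) - t * p y) ->
  m <= shear p y x.
Proof. by move=> h; apply: lb_le_inf => // _ [t /= t0 <-]; exact: h. Qed.

Lemma shear_sublinear : sublinear (shear p y).
Proof.
split=> [x z|t x].
  rewrite -lerBlDr; apply: shear_ge => t t0.
  rewrite lerBlDr [leRHS]addrC -lerBlDr; apply: shear_ge => s s0.
  have := shear_le (x + z) (addr_ge0 s0 t0).
  have := ps.1 (x + t *: y) (z + s *: y).
  rewrite addrACA -scalerDl [t + s]addrC mulrDl => h1 h2; lra.
rewrite le_eqVlt => /predU1P[<-|t0].
  rewrite scale0r mul0r (le_trans (shear_le 0 (lexx 0)))//.
  by rewrite scale0r addr0 mul0r subr0 sublinear0.
rewrite -ler_pdivrMl//; apply: shear_ge => s s0.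
rewrite ler_pdivrMl// (le_trans (@shear_le _ (t * s) _))//.
  by rewrite mulr_ge0// ltW.
by rewrite -scalerA -scalerDr (sublinearZ _ ps (ltW t0)) mulrBr mulrA.
Qed.

End shear.

(* A minimal sublinear functional is linear: it cannot lie strictly above any of its shears. *)
Lemma exists_linear_le (V : lmodType R) (p : V -> R) : sublinear p ->
  exists f : {linear V -> R^o}, forall x, f x <= p x.
Proof.
move=> ps.
pose T := {q : V -> R | sublinear q /\ forall x, q x <= p x}.
pose Q (q r : T) : bool := `[< forall x, sval r x <= sval q x >].
have t0 : T by exists p.
have [||A totA|[q [qs qp]] qmax] := @ZL_preorder T t0 Q.
- by move=> t; apply/asboolP.
- move=> r s t /asboolP rs /asboolP st; apply/asboolP => x.
  exact: le_trans (st x) (rs x).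
- have [A0|/set0P[q0 Aq0]] := eqVneq A set0; first by exists t0 => s; rewrite A0.
  pose m x := inf [set sval q x | q in A].
  have lbA x : has_lbound [set sval q x | q in A].
    exists (- p (- x)) => _ [[q [qs qp]] /= _ <-].
    by rewrite (le_trans _ (sublinear_geN x qs))// lerN2.
  have neA x : [set sval q x | q in A] !=set0 by exists (sval q0 x), q0.
  have mle q x : A q -> m x <= sval q x by move=> Aq; apply: ge_inf => //; exists q.
  have ms : sublinear m.
    split=> [x y|t x].
      rewrite -lerBlDr; apply: lb_le_inf => // _ [q1 Aq1 <-].
      rewrite lerBlDr [leRHS]addrC -lerBlDr; apply: lb_le_inf => // _ [q2 Aq2 <-].
      have [q [Aq q1q q2q]] : exists q, [/\ A q, sval q x <= sval q1 x
          & sval q y <= sval q2 y].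
        by have [/asboolP h|/asboolP h] := totA _ _ Aq1 Aq2;
          [exists q2|exists q1]; split.
      have := mle _ (x + y) Aq; have := (svalP q).1.1 x y; lra.
    rewrite le_eqVlt => /predU1P[<-|t1].
      rewrite scale0r mul0r (le_trans (mle _ 0 Aq0))// sublinear0//.
      exact: (svalP q0).1.
    rewrite -ler_pdivrMl//; apply: lb_le_inf => // _ [q Aq <-].
    rewrite ler_pdivrMl// (le_trans (mle q _ Aq))//.
    by rewrite (sublinearZ _ (svalP q).1 (ltW t1)).
  have mp x : m x <= p x by rewrite (le_trans (mle _ _ Aq0))// (svalP q0).2.
  by exists (exist _ m (conj ms mp)) => q Aq; apply/asboolP => x /=; exact: mle.
(* By minimality [q] lies below its shear, and the term [t = 1] of the shear then reads
   [q x <= q (x + y) - q y]. *)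
have qD x y : q (x + y) = q x + q y.
  apply/eqP; rewrite eq_le qs.1/=.
  have sp z : shear q y z <= p z.
    have := shear_le qs y z (lexx 0); rewrite scale0r addr0 mul0r subr0.
    by move=> /le_trans; apply.
  have /asboolP/= := qmax (exist _ (shear q y) (conj (shear_sublinear qs y) sp)).
  have h : Q (exist _ q (conj qs qp))
      (exist _ (shear q y) (conj (shear_sublinear qs y) sp)).
    apply/asboolP => z /=.
    by have := shear_le qs y z (lexx 0); rewrite scale0r addr0 mul0r subr0.
  move=> /asboolP; rewrite /Q /= => /(_ h)/asboolP/(_ x)/= hx.
  have := shear_le qs y x ler01; rewrite scale1r mul1r => h2; lra.
have qN x : q (- x) = - q x.
  by apply/eqP; rewrite -addr_eq0 -qD addNr sublinear0.
have ql : linear (q : V -> R^o).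
  move=> a x y; rewrite qD; congr (_ + _).
  have [a0|a0] := leP 0 a; first exact: sublinearZ.
  by rewrite -[a]opprK scaleNr qN sublinearZ ?oppr_ge0 1?ltW// -mulNr.
pose lin := GRing.isLinear.Build R V R^o *:%R q ql.
pose g : {linear V -> R^o} := HB.pack (q : V -> R^o) lin.
by exists g.
Qed.

(** A functional below the shear in direction [y] has [f (- y) <= - p y], which forces equality at
    [y]. *)
Lemma hahn_banach (V : lmodType R) (p : V -> R) (y : V) : sublinear p ->
  exists2 f : {linear V -> R^o}, forall x, f x <= p x & f y = p y.
Proof.
move=> ps; have [f fp] := exists_linear_le (shear_sublinear ps y).
have fp' x : f x <= p x.
  rewrite (le_trans (fp x))// (le_trans (shear_le ps y x (lexx 0)))//.
  by rewrite scale0r addr0 mul0r subr0.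
exists f => //; apply/eqP; rewrite eq_le fp'/=.
have := le_trans (fp (- y)) (shear_le ps y (- y) ler01).
by rewrite scale1r mul1r addNr sublinear0// sub0r linearN lerN2.
Qed.

Definition seminorm (V : lmodType R) (p : V -> R) :=
  (forall x y, p (x + y) <= p x + p y) /\
  (forall t x, p (t *: x) <= `|t| * p x).

Lemma seminorm_sublinear (V : lmodType R) (p : V -> R) :
  seminorm p -> sublinear p.
Proof. by move=> [pD pZ]; split=> // t x t0; rewrite (le_trans (pZ _ _))// ger0_norm. Qed.

Lemma seminormN (V : lmodType R) (p : V -> R) x : seminorm p -> p (- x) = p x.
Proof.
move=> [pD pZ]; apply/eqP; rewrite eq_le; apply/andP; split.
  by have := pZ (-1) x; rewrite scaleN1r normrN1 mul1r.
by have := pZ (-1) (- x); rewrite scaleN1r normrN1 mul1r opprK.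
Qed.

Lemma seminorm_ge0 (V : lmodType R) (p : V -> R) x : seminorm p -> 0 <= p x.
Proof.
move=> ps; have := sublinear_geN x (seminorm_sublinear ps).
rewrite seminormN//; lra.
Qed.

(** Hahn-Banach for the quotient seminorm [q z = inf_(d in D) p (z + d)]: it is at most 0 on the
    subspace [D], so a linear functional below it vanishes there, and [c <= q y]. *)
Lemma hahn_banach_annihilator (V : lmodType R) (p : V -> R) (D : set V) y c :
  seminorm p -> D 0 -> (forall a u v, D u -> D v -> D (a *: u + v)) ->
  (forall d, D d -> c <= p (y + d)) ->
  exists f : {linear V -> R^o},
    [/\ forall x, f x <= p x, forall d, D d -> f d = 0 & c <= f y].
Proof.
move=> ps D0 DL cp.
pose q z := inf [set p (z + d) | d in D].
have lbq z : has_lbound [set p (z + d) | d in D].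
  by exists 0 => _ [d _ <-]; exact: seminorm_ge0.
have neq0 z : [set p (z + d) | d in D] !=set0 by exists (p (z + 0)), 0.
have qle z d : D d -> q z <= p (z + d) by move=> Dd; apply: ge_inf => //; exists d.
have qs : sublinear q.
  split=> [x z|t x].
    rewrite -lerBlDr; apply: lb_le_inf => // _ [d Dd <-].
    rewrite lerBlDr [leRHS]addrC -lerBlDr; apply: lb_le_inf => // _ [e De <-].
    have De' : D (1 *: d + e) by exact: DL.
    have := qle (x + z) _ De'; rewrite scale1r addrACA.
    have := ps.1 (x + d) (z + e); lra.
  rewrite le_eqVlt => /predU1P[<-|t0].
    rewrite scale0r mul0r (le_trans (qle 0 _ D0))// addr0 sublinear0//.
    exact: seminorm_sublinear.
  rewrite -ler_pdivrMl//; apply: lb_le_inf => // _ [d Dd <-].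
  rewrite ler_pdivrMl//.
  have Dd' : D (t *: d + 0) by exact: DL.
  rewrite (le_trans (qle _ _ Dd'))// addr0 -scalerDr.
  by rewrite (le_trans (ps.2 _ _))// gtr0_norm.
have [f fq fy] := hahn_banach y qs.
have DN d : D d -> D (- d) by move=> Dd; rewrite -scaleN1r -[_ *: _]addr0; exact: DL.
have fD0 d : D d -> f d <= 0.
  move=> Dd; rewrite (le_trans (fq _))// (le_trans (qle _ _ (DN _ Dd)))//.
  by rewrite subrr sublinear0//; exact: seminorm_sublinear.
exists f; split.
- by move=> x; rewrite (le_trans (fq _))// (le_trans (qle _ _ D0))// addr0.
- move=> d Dd; apply/eqP; rewrite eq_le fD0//=.
  by have := fD0 _ (DN _ Dd); rewrite linearN oppr_le0.
- by rewrite fy; apply: lb_le_inf => // _ [d Dd <-]; exact: cp.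
Qed.

End hahn_banach.

(** * Simultaneous approximation in finitely many seminorms *)

Section separation.
Context {R : realType}.

(** [w i] is the supremum of [psi i] over the ball [p i x <= c i]. The [z i] vary independently, so
    the suprema may be added. Where [p i x = 0], all multiples of [x] lie in the ball, which forces
    [psi i x <= 0]. *)
Lemma weights_of_linear_sum_le1 (V : lmodType R) (I : finType) (p : I -> V -> R)
    (psi : I -> {linear V -> R^o}) (c : I -> R) :
  (forall i, seminorm (p i)) -> (forall i, 0 < c i) ->
  (forall z, (forall i, p i (z i) <= c i) -> \sum_i psi i (z i) <= 1) ->
  exists w : I -> R, [/\ forall i, 0 <= w i, \sum_i w i <= 1
    & forall i x, psi i x <= w i * (p i x / c i)].
Proof.
move=> ps c0 psi1.
have p0 i : p i 0 = 0 by apply/sublinear0/seminorm_sublinear.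
have psi1i i x : p i x <= c i -> psi i x <= 1.
  move=> pix; have := psi1 (fun j => if j == i then x else 0).
  rewrite (bigD1 i)//= eqxx big1 ?addr0.
    by apply => j; case: eqVneq => [->//|_]; rewrite p0 ltW.
  by move=> j /negbTE ->; exact: linear0.
pose w i := sup [set psi i x | x in [set x | p i x <= c i]].
have ubw i : has_ubound [set psi i x | x in [set x | p i x <= c i]].
  by exists 1 => _ [x /= ? <-]; exact: psi1i.
have new i : [set psi i x | x in [set x | p i x <= c i]] !=set0.
  by exists (psi i 0), 0 => //=; rewrite p0 ltW.
have lew i x : p i x <= c i -> psi i x <= w i.
  by move=> pix; apply: ub_le_sup => //; exists x.
exists w; split.
- by move=> i; rewrite -(linear0 (psi i)); apply: lew; rewrite p0 ltW.
- apply/ler_addgt0Pr => e e0.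
  pose d := e / (#|I|.+1)%:R.
  have d0 : 0 < d by rewrite divr_gt0.
  have /choice[z zP] : forall i, exists x, p i x <= c i /\ w i - d < psi i x.
    move=> i; have [_ [x /= px <-] wx] := sup_adherent d0 (conj (new i) (ubw i)).
    by exists x.
  have := psi1 z (fun i => (zP i).1).
  have : \sum_i (w i - d) <= \sum_i psi i (z i).
    by apply: ler_sum => i _; rewrite ltW// (zP i).2.
  rewrite sumrB sumr_const => h1 h2.
  have : d *+ #|I| <= e.
    rewrite -mulr_natr /d -mulrA ler_piMr ?(ltW e0)// ler_pdivrMl// mulr1.
    by rewrite ler_nat.
  lra.
- move=> i x.
  have [px0|] := eqVneq (p i x) 0.
    rewrite px0 mul0r mulr0 leNgt; apply/negP => psi0.
    have pr : p i ((2 / psi i x) *: x) <= c i.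
      by rewrite (le_trans ((ps i).2 _ _))// px0 mulr0 ltW.
    have := psi1i i _ pr; rewrite linearZ /= /GRing.scale/= divfK ?gt_eqF//; lra.
  rewrite neq_lt ltNge seminorm_ge0//= => px0.
  have r0 : 0 < c i / p i x by rewrite divr_gt0.
  have pr : p i ((c i / p i x) *: x) <= c i.
    by rewrite (le_trans ((ps i).2 _ _))// gtr0_norm// divfK ?gt_eqF.
  have := lew i _ pr; rewrite linearZ /= /GRing.scale/=.
  by rewrite -ler_pdivlMl// invf_div mulrC.
Qed.

(** Hahn-Banach on the product of copies of [V] with the seminorm [max_i p i / c i]: by hypothesis
    [y] is at distance at least 1 from the diagonal, and a functional annihilating the diagonal
    splits into components [psi i] with sum 0. *)
Lemma finite_seminorm_alternative (V : lmodType R) (I : finType)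
    (p : I -> V -> R) (y : I -> V) (c : I -> R) :
  (forall i, seminorm (p i)) -> (forall i, 0 < c i) ->
  (forall v, exists i, c i <= p i (v - y i)) ->
  exists (psi : I -> {linear V -> R^o}) (w : I -> R),
    [/\ forall i, 0 <= w i, \sum_i w i <= 1,
        forall i x, psi i x <= w i * (p i x / c i),
        forall x, \sum_i psi i x = 0 & 1 <= \sum_i psi i (y i)].
Proof.
move=> ps c0 nov.
pose P (z : I -> V) := \big[Num.max/0]_i (p i (z i) / c i).
have PP z i : p i (z i) / c i <= P z by exact: le_bigmax.
have P0 z : 0 <= P z by exact: bigmax_ge_id.
have PM z M : 0 <= M -> (forall i, p i (z i) <= M * c i) -> P z <= M.
  by move=> M0 h; apply: bigmax_le => // i _; rewrite ler_pdivrMr.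
have Pp z i : p i (z i) <= P z * c i by rewrite -ler_pdivrMr.
have Ps : seminorm P.
  split=> [x z|t x]; apply: PM; rewrite ?addr_ge0 ?mulr_ge0// => i.
    by rewrite (le_trans ((ps i).1 _ _))// mulrDl lerD.
  by rewrite (le_trans ((ps i).2 _ _))// -mulrA ler_wpM2l.
pose D : set (I -> V) := [set z | exists v, z = fun=> v].
have [|a _ _ [u ->] [v ->]|_ [v ->]|f [fP fD fy]] :=
    hahn_banach_annihilator (D := D) (y := y) (c := 1) Ps.
- by exists 0.
- by exists (a *: u + v).
- have [i ci] := nov (- v); apply: le_trans (PP _ i).
  rewrite ler_pdivlMr// mul1r (le_trans ci)//.
  by rewrite -seminormN// opprD opprK addrC opprK.
pose dl i (x : V) : I -> V := fun j => if j == i then x else 0.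
have dll i : linear (fun x => f (dl i x) : R^o).
  move=> a x z; rewrite -linearP; congr (f _); apply/funext => j.
  by rewrite /dl !fctE; case: eqP => // _; rewrite scaler0 addr0.
pose psi i : {linear V -> R^o} :=
  HB.pack (fun x => f (dl i x) : R^o)
    (GRing.isLinear.Build R V R^o *:%R (fun x => f (dl i x) : R^o) (dll i)).
have psiE z : \sum_i psi i (z i) = f z.
  rewrite /= -linear_sum; congr (f _); apply/funext => j.
  rewrite fct_sumE (bigD1 j)//= /dl eqxx big1 ?addr0// => i.
  by rewrite eq_sym => /negbTE ->.
have [|w [w0 w1 wp]] := weights_of_linear_sum_le1 (psi := psi) ps c0.
  move=> z pz; rewrite psiE (le_trans (fP _))// PM// => i.
  by rewrite mul1r.
exists psi, w; split => //.
- by move=> x; rewrite (psiE (fun=> x)) fD//; exists x.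
- by rewrite psiE.
Qed.

End separation.

(** * Interpolation in a space whose dual is [ell1] *)

HB.instance Definition _ (R : realType) (X : normedModType R) (f : dual X) :=
  GRing.isLinear.Build R X R^o *:%R (dual_val f) (dualP f).1.

Section dual_theory.
Context {R : realType} {X : normedModType R}.
Implicit Types (f g : dual X) (x : X).

Lemma dual_eqP f g : (forall x, f x = g x) -> f = g.
Proof. by move=> fg; apply/val_inj/funext. Qed.

Lemma dualBE f g x : (f - g) x = f x - g x. Proof. by []. Qed.
Lemma dualZE (a : R) f x : (a *: f) x = a * f x. Proof. by []. Qed.
Lemma dual0E x : (0 : dual X) x = 0. Proof. by []. Qed.
Lemma dual_sumE (I : Type) (s : seq I) (F : I -> dual X) x :
  (\sum_(i <- s) F i) x = \sum_(i <- s) F i x.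
Proof. by rewrite (big_morph (fun f : dual X => f x) (id1 := 0) (op1 := +%R)). Qed.

Lemma dual_linearZ f (a : R) x : f (a *: x) = a * f x.
Proof. exact: linearZ. Qed.

Lemma dual_linearP f (a : R) x y : f (a *: x + y) = a * f x + f y.
Proof. exact: (dualP f).1. Qed.

Lemma dual_linearBZ f (a : R) x y : f (x - a *: y) = f x - a * f y.
Proof. by rewrite linearB /= dual_linearZ. Qed.

Lemma le_dual_norm f x : `|f x| <= `|f| * `|x|.
Proof.
have [->|x0] := eqVneq x 0; first by rewrite linear0 !normr0 mulr0.
have xN : 0 < `|x| by rewrite normr_gt0.
have := supnorm_ub (dual_bounded f) (t := `|x|^-1 *: x).
rewrite dual_linearZ normrM normfV normr_id.
rewrite -ler_pdivrMr// mulrC => ->//.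
by rewrite /unit_ball /= normrZ normfV normr_id mulVf ?gt_eqF.
Qed.

Lemma dual_norm_le f M : 0 <= M -> (forall x, `|f x| <= M * `|x|) -> `|f| <= M.
Proof.
move=> M0 fM; apply: supnorm_le; first by exists 0; rewrite /unit_ball/= normr0.
by move=> x /= x1; rewrite (le_trans (fM x))// ler_piMr.
Qed.

Lemma exists_dual (p : {linear X -> R^o}) M :
  (forall x, `|p x| <= M * `|x|) -> exists f : dual X, forall x, f x = p x.
Proof.
move=> pM; have dp : (p : X -> R^o) \in @in_dual R X.
  apply/asboolP; split; first exact: linearP.
  apply/linear_bounded_continuous/linear_boundedP.
  by near=> N => x; rewrite (le_trans (pM x))// ler_wpM2r//; near: N; exact: nbhs_pinfty_ge.
by exists (Dual dp).
Unshelve. all: by end_near. Qed.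

Lemma dual_comb f (p : {linear X -> R^o}) M :
  (forall x, p x <= M * `|f x|) -> exists l : R, forall x, p x = l * f x.
Proof.
move=> pM; have pN x : `|p x| <= M * `|f x|.
  by rewrite ler_norml pM andbT lerNl -linearN (le_trans (pM _))// linearN normrN.
have [[x0 fx0]|/forallNP f0] := pselect (exists x0, f x0 != 0).
  exists (p x0 / f x0) => x; have := pN (f x0 *: x - f x *: x0).
  rewrite [f (_ - _)]linearB /= !dual_linearZ [f x0 * _]mulrC subrr normr0 mulr0.
  rewrite normr_le0 linearB !linearZ /= /GRing.scale/= mulrN subr_eq0 => /eqP h.
  by apply: (mulfI fx0); rewrite h mulrAC [RHS]mulrC divfK// mulrC.
exists 0 => x; apply/eqP; rewrite mul0r -normr_le0 (le_trans (pN _))//.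
by have /negP := f0 x; rewrite negbK => /eqP ->; rewrite normr0 mulr0.
Qed.

End dual_theory.

Lemma exists_bidual_eval (R : realType) (X : normedModType R) (x : X) :
  exists U : dual (dual X), forall f, U f = f x.
Proof.
have evl : linear (fun f : dual X => f x : R^o) by move=> a f g.
pose ev : {linear dual X -> R^o} := HB.pack (fun f : dual X => f x : R^o)
  (GRing.isLinear.Build R _ R^o *:%R (fun f : dual X => f x : R^o) evl).
have [f|U UE] := @exists_dual _ _ ev `|x|; first by rewrite mulrC le_dual_norm.
by exists U.
Qed.

(** A form of Helly's theorem: if no such [v] exists, separation gives functionals [G i] with sum 0.
    Evaluating them at [U] in place of a common vector is contradictory, because [U] meets every
    constraint with a strictly smaller radius. *)
Lemma bidual_approx (R : realType) (X : normedModType R) (U : dual (dual X))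
    (S : finType) (y : S -> X) (r : S -> R) (fs : seq (dual X)) (e : R) :
  (forall s, 0 <= r s) ->
  (forall s f, `|U f - f (y s)| <= r s * `|f|) -> 0 < e ->
  exists v, (forall s, `|v - y s| <= r s + e) /\
    forall f, f \in fs -> `|f v - U f| <= e.
Proof.
move=> r0 Uy e0; apply: contrapT => nov.
pose n := size fs; pose I := (S + 'I_n)%type.
pose ff (i : 'I_n) : dual X := nth 0 fs i.
(* Each condition on [f v] is recast as a ball of the seminorm [|f|] around a point of X with the
   prescribed value [U f]. *)
have /choice[z zP] : forall i, exists z, ff i z = U (ff i).
  move=> i; have [[x0 fx0]|/forallNP f0] := pselect (exists x0, ff i x0 != 0).
    by exists ((U (ff i) / ff i x0) *: x0); rewrite dual_linearZ divfK.
  suff -> : ff i = 0 by exists 0; rewrite dual0E [RHS]linear0.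
  by apply: dual_eqP => x; have /negP := f0 x; rewrite negbK => /eqP.
pose p (i : I) : X -> R := match i with
  inl _ => fun x => `|x| | inr i => fun x => `|ff i x| end.
pose yy (i : I) : X := match i with inl s => y s | inr i => z i end.
pose c (i : I) : R := match i with inl s => r s + e | inr i => e end.
(* The radius at which [U] meets constraint [i], relative to the radius [c i] allowed for [v]; the
   maximum [t] of these ratios is below 1. *)
pose th (i : I) : R := match i with inl s => r s / (r s + e) | inr i => 0 end.
have ps i : seminorm (p i).
  case: i => i; split=> [x w|t x] /=.
  - exact: ler_normD.
  - by rewrite normrZ.
  - by rewrite linearD; exact: ler_normD.
  - by rewrite dual_linearZ normrM.
have c0 i : 0 < c i by case: i => i//=; rewrite ltr_wpDl.
have [|psi [w [w0 w1 pw psi0 psi1]]] := finite_seminorm_alternative (y := yy) ps c0.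
  move=> v; apply: contrapT => /forallNP h; apply: nov; exists v.
  have {}h i : p i (v - yy i) < c i by rewrite ltNge; apply/negP.
  split=> [s|f /(nthP 0)[i ilt <-]]; first exact: ltW (h (inl s)).
  by have := h (inr (Ordinal ilt)); rewrite /= linearB /= zP => /ltW.
have psib i : exists M, forall x, `|psi i x| <= M * `|x|.
  have [M pM] : exists M, forall x, p i x <= M * `|x|.
    case: i => i; first by exists 1 => x; rewrite mul1r.
    by exists `|ff i| => x; exact: le_dual_norm.
  exists (w i / c i * M) => x.
  have h u : psi i u <= w i / c i * M * `|u|.
    rewrite (le_trans (pw i u))// -!mulrA ler_wpM2l// [leLHS]mulrC.
    by rewrite ler_wpM2l ?invr_ge0 ?(ltW (c0 i)).
  by rewrite ler_norml h andbT lerNl -linearN (le_trans (h _))// normrN.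
have /choice[G GE] : forall i, exists g : dual X, forall x, g x = psi i x.
  by move=> i; have [M /exists_dual] := psib i.
have G0 : \sum_i G i = 0.
  by apply: dual_eqP => x; rewrite dual_sumE dual0E -[RHS](psi0 x); apply: eq_bigr.
have Gth i : psi i (yy i) - U (G i) <= w i * th i.
  case: i => i /=.
    rewrite -GE (le_trans (ler_norm _))// distrC (le_trans (Uy i _))//.
    rewrite mulrCA ler_wpM2l//.
    apply: dual_norm_le; first by rewrite mulr_ge0// invr_ge0 ltW// (c0 (inl i)).
    have h u : psi (inl i) u <= w (inl i) / (r i + e) * `|u|.
      by rewrite (le_trans (pw (inl i) u))//= mulrA mulrAC.
    by move=> x; rewrite GE ler_norml h andbT lerNl -linearN (le_trans (h _))// normrN.
  have [|l lE] := @dual_comb _ _ (ff i) (psi (inr i)) (w (inr i) / e).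
    by move=> x; rewrite (le_trans (pw (inr i) x))//= mulrA mulrAC.
  have -> : G (inr i) = l *: ff i by apply: dual_eqP => x; rewrite GE lE.
  by rewrite dual_linearZ lE zP subrr mulr0.
pose t := \big[Num.max/0]_i th i.
have t1 : t < 1.
  apply: bigmax_lt => // -[s|i] _ //=.
  by rewrite ltr_pdivrMr ?mul1r ?ltrDl// (c0 (inl s)).
have : \sum_i (psi i (yy i) - U (G i)) <= t * \sum_i w i.
  rewrite mulr_sumr; apply: ler_sum => i _; rewrite (le_trans (Gth i))//.
  by rewrite mulrC ler_wpM2r// le_bigmax.
rewrite sumrB -[X in _ - X]linear_sum G0 linear0 subr0.
have : t * \sum_i w i <= t by rewrite ler_piMr// bigmax_ge_id.
lra.
Qed.

Lemma cauchy_limit (R : realType) (X : completeNormedModType R) (u : nat -> X) :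
  (forall e, 0 < e -> exists N, forall n, (N <= n)%N -> `|u n - u N| <= e) ->
  exists l : X, u @ \oo --> l.
Proof.
move=> uC; apply/cvg_ex/cauchy_cvgP; apply: cauchy_exP => e e0.
have [N uN] := uC _ (divr_gt0 e0 (ltr0n _ 2)).
exists (u N); suff : \forall n \near \oo, ball (u N) e (u n) by [].
near=> n; rewrite -ball_normE /ball_/= distrC.
rewrite (le_lt_trans (uN _ _)) ?ltr_pdivrMr//; last by lra.
by near: n; exact: nbhs_infty_ge.
Unshelve. all: by end_near. Qed.

(** [G v e] is to be read as [v] being a solution up to the error [e]. Halving the error costs a
    move of [K * e], and the geometric series sums to [K * e0 * 2]. The conclusion offers
    approximate solutions arbitrarily close to [v], in place of a closedness assumption on [G]. *)
Lemma geometric_refinement (R : realType) (X : completeNormedModType R)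
    (G : X -> R -> Prop) (K e0 : R) (v0 : X) :
  0 <= K -> 0 < e0 ->
  (forall v e, 0 < e -> G v e -> exists v', G v' (e / 2) /\ `|v' - v| <= K * e) ->
  G v0 e0 ->
  exists v, `|v - v0| <= K * e0 * 2 /\
    forall d, 0 < d -> exists w e, [/\ `|v - w| <= d, 0 < e, e <= d & G w e].
Proof.
move=> K0 e00 Gstep G0.
have /choice[stp stpP] : forall ve : X * R, exists v', 0 < ve.2 -> G ve.1 ve.2 ->
    G v' (ve.2 / 2) /\ `|v' - ve.1| <= K * ve.2.
  move=> [v e] /=; have [e0'|] := boolP (0 < e); last by exists v.
  have [Gv|] := pselect (G v e); last by exists v.
  by have [v' ?] := Gstep v e e0' Gv; exists v'.
pose u := fix u n := if n is n'.+1 then stp (u n', e0 / 2 ^+ n') else v0.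
have en n : 0 < e0 / 2 ^+ n by rewrite divr_gt0// exprn_gt0.
have enS n : e0 / 2 ^+ n / 2 = e0 / 2 ^+ n.+1.
  by rewrite exprSr invfM mulrA.
have uG n : G (u n) (e0 / 2 ^+ n).
  elim: n => [|n IH] /=; first by rewrite expr0 divr1.
  by rewrite -enS; exact: (stpP (u n, e0 / 2 ^+ n) (en n) IH).1.
have us n : `|u n.+1 - u n| <= K * (e0 / 2 ^+ n).
  exact: (stpP (u n, e0 / 2 ^+ n) (en n) (uG n)).2.
have ud n k : `|u (n + k)%N - u n| <= K * (e0 / 2 ^+ n - e0 / 2 ^+ (n + k)) * 2.
  elim: k => [|k IH]; first by rewrite addn0 !subrr normr0 mulr0 mul0r.
  rewrite addnS -(subrKA (u (n + k)%N)) (le_trans (ler_normD _ _))//.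
  have := us (n + k)%N; rewrite -enS; move: IH; lra.
have un n k : (n <= k)%N -> `|u k - u n| <= K * (e0 / 2 ^+ n) * 2.
  move=> nk; have := ud n (k - n)%N; rewrite subnKC// => /le_trans; apply.
  by rewrite ler_wpM2r// ler_wpM2l// gerBl ltW.
have small d : 0 < d -> exists n, e0 / 2 ^+ n <= d /\ K * (e0 / 2 ^+ n) * 2 <= d.
  move=> d0; pose d' := d / (1 + K * 2).
  have K1 : 0 < 1 + K * 2 by rewrite ltr_pwDl// mulr_ge0.
  have d'0 : 0 < d' / e0 by rewrite !divr_gt0.
  have /cvgrPdist_le/(_ _ d'0)[n _ /(_ n (leqnn n))] :
      (GRing.exp (2^-1 : R)) @ \oo --> (0 : R).
    by apply: cvg_expr; rewrite ger0_norm ?invr_ge0// invf_lt1// ltr1n.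
  rewrite /= sub0r normrN exprVn ger0_norm ?invr_ge0 ?exprn_ge0//.
  rewrite ler_pdivlMr// mulrC => h; exists n.
  have hd : d' * (1 + K * 2) = d by rewrite divfK// gt_eqF.
  have : 0 < d' by rewrite divr_gt0.
  have : K * (e0 / 2 ^+ n) <= K * d' by rewrite ler_wpM2l.
  have : 0 <= K * d' by rewrite mulr_ge0// ltW// divr_gt0.
  by move=> *; split; lra.
have [v uv] : exists v : X, u @ \oo --> v.
  by apply: cauchy_limit => e /small[n [_ h]]; exists n => k /un/le_trans; exact.
have vn n : `|v - u n| <= K * (e0 / 2 ^+ n) * 2.
  have : (fun k => `|u k - u n|) @ \oo --> `|v - u n|.
    by apply: cvg_norm; apply: cvgB => //; exact: cvg_cst.
  move=> /cvgr_to_le; apply; near=> k; apply: un.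
  by near: k; exact: nbhs_infty_ge.
exists v; split; first by have := vn 0%N; rewrite expr0 divr1.
move=> d /small[n [h1 h2]]; exists (u n), (e0 / 2 ^+ n); split => //.
exact: le_trans (vn n) _.
Unshelve. all: by end_near. Qed.

(* Moving [t] towards a common point of the intervals never leaves an interval it is in, so a shift by [e] repairs an error [e] in all of them. *)
Lemma clip_intervals (R : realType) (S : Type) (c r : S -> R) (b t e : R) :
  0 < e -> (forall s, `|b - c s| <= r s) -> (forall s, `|t - c s| <= r s + e) ->
  exists t', (forall s, `|t' - c s| <= r s) /\ `|t' - t| <= e.
Proof.
move=> e0 hb ht.
have [tb|bt] := leP t (b + e); [have [bt|tb'] := leP (b - e) t|].
- by exists b; split=> //; rewrite ler_norml; lra.
- exists (t + e); split=> [s|]; last by rewrite addrAC subrr add0r gtr0_norm.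
  by have := hb s; have := ht s; rewrite !ler_norml; lra.
- exists (t - e); split=> [s|].
    by have := hb s; have := ht s; rewrite !ler_norml; lra.
  by rewrite addrAC subrr add0r normrN gtr0_norm.
Qed.

Lemma norming_functional (R : realType) (X : normedModType R) (x : X) :
  exists f : dual X, `|f| <= 1 /\ f x = `|x|.
Proof.
have ns : seminorm (fun z : X => `|z|).
  by split=> [u v|t u]; [exact: ler_normD|rewrite normrZ].
have [f fle fx] := hahn_banach x (seminorm_sublinear ns).
have fN z : `|f z| <= 1 * `|z|.
  by rewrite mul1r ler_norml fle andbT lerNl -linearN (le_trans (fle _))// normrN.
have [g gf] := exists_dual fN; exists g; split; last by rewrite gf.
by apply: dual_norm_le => // z; rewrite gf.
Qed.

(* [e] behaves like the unit vectors of [ell1 = X^*]; the last clause says that every bounded sequence is an element of [X^**]. *)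
Definition ell1_basis (R : realType) (X : normedModType R) (e : nat -> dual X) :=
  [/\ forall j, `|e j| <= 1,
      forall f : dual X, exists2 a : ell1 R, `|f| = `|a| &
        forall U : dual (dual X), series (fun j => a j * U (e j)) @ \oo --> (U f : R)
    & forall (b : nat -> R) M, (forall j, `|b j| <= M) ->
        exists U : dual (dual X), forall j, U (e j) = b j].

Lemma ell1_norm_ge (R : realType) (a : ell1 R) n : \sum_(0 <= j < n) `|a j| <= `|a|.
Proof.
rewrite -[\sum_(0 <= j < n) _]/([series `|a n|]_n n).
apply: nondecreasing_cvgn_le; last exact: ell1P.
by apply/nondecreasing_seqP => k; rewrite /series/= big_nat_recr//= lerDl.
Qed.

Section ell1_basis_theory.
Context {R : realType} {X : completeNormedModType R} (e : nat -> dual X).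
Hypothesis eb : ell1_basis e.

Lemma basis_bidual_le (U : dual (dual X)) (x : X) M f : 0 <= M ->
  (forall j, `|U (e j) - e j x| <= M) -> `|U f - f x| <= M * `|f|.
Proof.
move=> M0 UM; have [_ /(_ f)[a -> aU] _] := eb.
have [V VE] := exists_bidual_eval x.
have : (fun n => `|series (fun j => a j * U (e j)) n
    - series (fun j => a j * V (e j)) n|) @ \oo --> `|U f - V f|.
  by apply: cvg_norm; apply: cvgB; exact: aU.
rewrite VE => /cvgr_to_le; apply; near=> n.
rewrite /series/= -sumrB (le_trans (ler_norm_sum _ _ _))//.
rewrite (@le_trans _ _ (\sum_(0 <= j < n) M * `|a j|))//; last first.
  by rewrite -mulr_sumr ler_wpM2l// ell1_norm_ge.
by apply: ler_sum => j _; rewrite -mulrBr normrM mulrC ler_wpM2r// VE.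
Unshelve. all: by end_near. Qed.

Lemma basis_norm_le (x : X) M : 0 <= M -> (forall j, `|e j x| <= M) -> `|x| <= M.
Proof.
move=> M0 xM; have [f [f1 <-]] := norming_functional x.
have [U UE] := exists_bidual_eval x.
have : `|U f - f 0| <= M * `|f|.
  by apply: basis_bidual_le => // j; rewrite linear0 subr0 UE.
rewrite linear0 subr0 UE => /(le_trans (ler_norm _))/le_trans; apply.
by rewrite ler_piMr.
Qed.

Lemma basis_val_le (x : X) j : `|e j x| <= `|x|.
Proof.
rewrite (le_trans (le_dual_norm _ _))// ler_piMl//; by case: eb.
Qed.

(* An approximate solution [v] is improved in the bidual: clip its coordinates into the balls, repair the value at [h] by a convex combination with [Um] or [Up], and come back to [X] by [bidual_approx]; this moves [v] by at most a multiple of its error and halves the error, so the iterates converge to an exact solution. *)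
Lemma exact_interpolation (S : finType) (s0 : S) (y : S -> X) (r : S -> R)
    (J : seq nat) (h : dual X) (fs : seq (dual X)) (U0 Um Up : dual (dual X)) (rho : R) :
  (forall s, 0 <= r s) -> 0 < rho ->
  (forall U, [\/ U = U0, U = Um | U = Up] ->
    (forall s j, `|U (e j) - e j (y s)| <= r s) /\
    forall j, j \in J -> U (e j) = U0 (e j)) ->
  Um h < 0 -> 0 < Up h -> U0 h = 0 ->
  exists v, [/\ forall s, `|v - y s| <= r s, forall j, j \in J -> e j v = U0 (e j),
    h v = 0 & forall f, f \in fs -> `|f v - U0 f| <= rho].
Proof.
move=> r0 rho0 UP Umh Uph U0h.
pose good v d := [/\ forall s, `|v - y s| <= r s + d,
  forall j, j \in J -> `|e j v - U0 (e j)| <= d & `|h v| <= d].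
pose eta := Num.min (- Um h) (Up h).
have eta0 : 0 < eta by rewrite lt_min oppr_gt0 Umh.
(* The summand 1 accounts for the clipping. The rest is the repair of [h]: a weight of at most
   [d * (1 + |h|) / eta], times the distance of two functionals that are both within [r s0] of
   [y s0]. *)
pose K := 1 + (1 + `|h|) / eta * (2 * r s0).
have K1 : 1 <= K by rewrite lerDl !mulr_ge0// ?invr_ge0 ?ltW// ltW// addr_gt0.
have Ks (U : dual (dual X)) : [\/ U = U0, U = Um | U = Up] ->
    forall s f, `|U f - f (y s)| <= r s * `|f|.
  by move=> /UP[UPU _] s f; exact: basis_bidual_le.
have step v d : 0 < d -> good v d ->
    exists v', good v' (d / 2) /\ `|v' - v| <= (K + 1) * d.
  move=> d0 [gS gJ gh].
  have /choice[b bP] : forall j, exists t, [/\ forall s, `|t - e j (y s)| <= r s,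
      `|t - e j v| <= d & j \in J -> t = U0 (e j)].
    move=> j; have [jJ|jJ] := boolP (j \in J).
      exists (U0 (e j)); split=> // [s|]; last by rewrite distrC gJ.
      by have [/(_ s j)] := UP U0 (Or31 _ _ erefl).
    have [||t [t1 t2]] := @clip_intervals R S (fun s => e j (y s)) r (U0 (e j)) (e j v) d d0.
    - by move=> s; have [/(_ s j)] := UP U0 (Or31 _ _ erefl).
    - by move=> s; rewrite -linearB (le_trans (basis_val_le _ _)).
    - by exists t.
  have [_ _ /(_ b (`|v| + d))[|U' U'b]] := eb.
    move=> j; have [_ + _] := bP j; have := basis_val_le v j.
    rewrite -{2}[b j](subrK (e j v)) => h1 h2.
    by rewrite (le_trans (ler_normD _ _))// addrC lerD.
  have U's s f : `|U' f - f (y s)| <= r s * `|f|.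
    by apply: basis_bidual_le => // j; rewrite U'b; case: (bP j).
  have U'v f : `|U' f - f v| <= d * `|f|.
    by apply: basis_bidual_le; rewrite ?ltW// => j; rewrite U'b; case: (bP j).
  have U'h : `|U' h| <= d * (1 + `|h|).
    rewrite -[U' h](subrK (h v)) (le_trans (ler_normD _ _))//.
    by rewrite mulrDr mulr1 addrC lerD.
  have [U1 [U1P [th [/andP[th0 th1] thd thU]]]] : exists U1 : dual (dual X),
      [\/ U1 = U0, U1 = Um | U1 = Up] /\ exists th, [/\ 0 <= th <= 1,
        th <= d * (1 + `|h|) / eta & (1 - th) * U' h + th * U1 h = 0].
    (* The weight [A / (A + B)] balances a value [A] against [- B]; it is small with [A], because
       [B] is at least [eta]. *)
    have thP (A B : R) : 0 <= A -> A <= d * (1 + `|h|) -> eta <= B ->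
        [/\ 0 <= A / (A + B) <= 1, A / (A + B) <= d * (1 + `|h|) / eta
          & (1 - A / (A + B)) * A - A / (A + B) * B = 0].
      move=> A0 Ah eB; have B0 : 0 < B by exact: lt_le_trans eB.
      have AB0 : 0 < A + B by rewrite ltr_wpDl.
      split; first by rewrite divr_ge0 ?(ltW AB0)//= ler_pdivrMr// mul1r lerDl ltW.
        apply: ler_pM => //; first by rewrite invr_ge0 ltW.
        by rewrite lef_pV2// (le_trans eB)// lerDr.
      by field; rewrite gt_eqF.
    have [U'0|U'0] := leP 0 (U' h).
      exists Um; split; first exact: Or32.
      have [|||t1 t2 t3] := thP (U' h) (- Um h) => //.
        by rewrite (le_trans (ler_norm _)).
        by rewrite ge_min lexx.
      by exists (U' h / (U' h - Um h)); split=> //; move: t3; rewrite mulrN opprK.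
    exists Up; split; first exact: Or33.
    have [|||t1 t2 t3] := thP (- U' h) (Up h).
    - by rewrite oppr_ge0 ltW.
    - by rewrite (le_trans (ler_norm _))// normrN.
    - by rewrite ge_min lexx orbT.
    - exists (- U' h / (- U' h + Up h)); split=> //.
      by apply/eqP; rewrite -oppr_eq0 opprD -mulrN t3.
  pose U : dual (dual X) := (1 - th) *: U' + th *: U1.
  have UE f : U f = (1 - th) * U' f + th * U1 f by [].
  have Us s f : `|U f - f (y s)| <= r s * `|f|.
    have -> : U f - f (y s) = (1 - th) * (U' f - f (y s)) + th * (U1 f - f (y s)).
      by rewrite UE; ring.
    rewrite (le_trans (ler_normD _ _))// !normrM (ger0_norm th0) (@ger0_norm _ (1 - th)) ?subr_ge0//.
    have -> : r s * `|f| = (1 - th) * (r s * `|f|) + th * (r s * `|f|) by ring.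
    by apply: lerD; apply: ler_wpM2l; rewrite ?subr_ge0//; exact: Ks.
  have Uv f : `|U f - f v| <= (K * d) * `|f|.
    have -> : U f - f v = (U' f - f v) + th * ((U1 f - f (y s0)) - (U' f - f (y s0))).
      by rewrite UE; ring.
    have -> : K * d * `|f| = d * `|f|
        + d * (1 + `|h|) / eta * (r s0 * `|f| + r s0 * `|f|) by rewrite /K; ring.
    rewrite (le_trans (ler_normD _ _))// lerD// normrM ger0_norm//.
    apply: ler_pM => //; rewrite (le_trans (ler_normB _ _))// lerD//.
    exact: Ks.
  (* The additional ball, indexed by [None], ties the new vector to [v], so that the step length
     stays proportional to the error [d]. *)
  have [||v' [v'P v'f]] := @bidual_approx R X U (option S)
    (fun s => if s is Some s then y s else v) (fun s => if s is Some s then r s else K * d)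
    (h :: [seq e j | j <- J]) (d / 2) _ _ (divr_gt0 d0 (ltr0n _ 2)).
  - by case=> // ; rewrite mulr_ge0 ?ltW// (lt_le_trans ltr01).
  - by case.
  exists v'; split; last first.
    have /= := v'P None; lra.
  split=> [s|j jJ|]; first exact: v'P (Some s).
    have := v'f (e j); rewrite inE map_f ?orbT// => /(_ isT); congr (`|_ - _| <= _).
    rewrite UE U'b; have [_ ->//] := UP _ U1P; have [_ _ ->//] := bP j.
    by rewrite -mulrDl subrK mul1r.
  by have := v'f h; rewrite inE eqxx UE thU subr0 => /(_ isT).
pose F := \sum_(f <- fs) `|f|.
have F0 : 0 <= F by apply: sumr_ge0.
have Fle f : f \in fs -> `|f| <= F.
  by move=> ffs; rewrite /F (big_rem f)//= lerDl sumr_ge0.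
(* The initial error [d0] and the total displacement [(K + 1) * d0 * 2], tested against any [f] in
   [fs], then add up to at most [rho]. *)
pose d0 := rho / (1 + (K + 1) * 2 * F).
have D0 : 0 < 1 + (K + 1) * 2 * F.
  by rewrite ltr_pwDl// !mulr_ge0// addr_ge0// (le_trans ler01).
have d00 : 0 < d0 by rewrite divr_gt0.
have [v0 [v0S v0f]] := bidual_approx (h :: [seq e j | j <- J] ++ fs) r0
  (Ks U0 (Or31 _ _ erefl)) d00.
have [||v [vv0 vlim]] := @geometric_refinement R X good (K + 1) d0 v0 _ d00 step.
- by rewrite addr_ge0// (le_trans ler01).
- split=> [s|j jJ|]; first exact: v0S.
    by apply: v0f; rewrite inE mem_cat map_f ?orbT.
  by have := v0f h; rewrite inE eqxx U0h subr0 => /(_ isT).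
have near0 (x z : R) : (forall d, 0 < d -> `|x| <= z + 2 * d) -> `|x| <= z.
  move=> H; apply/ler_addgt0Pr => d dp.
  by have := H _ (divr_gt0 dp (ltr0n _ 2)); rewrite mulrCA divff// mulr1.
have near1 (g : dual X) (z : R) : (forall d, 0 < d -> exists w, `|v - w| <= d /\
    `|g w - z| <= d) -> g v = z.
  move=> H; apply/eqP; rewrite -subr_eq0 -normr_le0; apply/ler_addgt0Pr => d dp.
  pose d' := d / (1 + `|g|).
  have d'0 : 0 < d' by rewrite divr_gt0// ltr_pwDl.
  have [w [vw gw]] := H _ d'0.
  have -> : g v - z = g (v - w) + (g w - z) by rewrite linearB /= subrKA.
  rewrite (le_trans (ler_normD _ _))// (le_trans (lerD (le_dual_norm _ _) gw))//.
  rewrite add0r -[leRHS](@divfK _ (1 + `|g|)); last by rewrite gt_eqF// ltr_pwDl.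
  by rewrite mulrDr mulr1 addrC lerD// mulrC ler_wpM2r.
exists v; split.
- move=> s; rewrite -[X in X <= _]normr_id; apply: near0 => d dp.
  have [w [d' [vw d'0 d'd [gS _ _]]]] := vlim d dp.
  rewrite normr_id -(subrKA w) (le_trans (ler_normD _ _))//.
  have := gS s; lra.
- move=> j jJ; apply: near1 => d dp.
  have [w [d' [vw d'0 d'd [_ gJ _]]]] := vlim d dp.
  by exists w; split=> //; rewrite (le_trans (gJ _ jJ)).
- apply: near1 => d dp.
  have [w [d' [vw d'0 d'd [_ _ gh]]]] := vlim d dp.
  by exists w; split=> //; rewrite subr0 (le_trans gh).
- move=> f ffs; have -> : f v - U0 f = f (v - v0) + (f v0 - U0 f).
    by rewrite linearB /= subrKA.
  rewrite (le_trans (ler_normD _ _))// (le_trans (lerD (le_dual_norm _ _) (v0f f _)))//.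
    by rewrite inE mem_cat ffs !orbT.
  have rE : rho = d0 * (1 + (K + 1) * 2 * F) by rewrite divfK// gt_eqF.
  rewrite rE mulrDr mulr1 addrC lerD2l (le_trans (ler_pM _ _ (Fle f ffs) vv0))//.
  by rewrite le_eqVlt; apply/orP; left; apply/eqP; ring.
Qed.

End ell1_basis_theory.

(** * Series in the dual and in [ell1] *)

Lemma big_nat_remove (V : zmodType) (F : nat -> V) n K : (n < K)%N ->
  \sum_(0 <= k < K) F k = F n + \sum_(0 <= k < K | k != n) F k.
Proof. by move=> nK; rewrite (bigD1_seq n)//= ?iota_uniq// mem_index_iota. Qed.

(** With signs that make every term agree in sign with [w], the absolute values add up. An [ell_1]
    bound on values thereby becomes finitely many norm conditions, one for each choice of signs. *)
Lemma signed_sum_le (R : realType) n (z : 'I_n -> R) (w M : R) :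
  (forall s : {ffun 'I_n -> bool}, `|\sum_i (-1) ^+ s i * z i + w| <= M) ->
  \sum_i `|z i| + `|w| <= M.
Proof.
move=> H; have [w0|w0] := leP 0 w.
  have := H [ffun i => z i < 0]; under eq_bigr do rewrite ffunE -normrEsign.
  by rewrite (ger0_norm w0) ger0_norm// addr_ge0// sumr_ge0.
have := H [ffun i => 0 <= z i]; under eq_bigr => i _.
  have -> : (-1) ^+ [ffun i => 0 <= z i] i * z i = - `|z i|.
    rewrite ffunE; case: leP => zi; first by rewrite ger0_norm// expr1 mulN1r.
    by rewrite ltr0_norm// expr0 mul1r opprK.
  over.
rewrite sumrN addrC -opprB normrN (ltr0_norm w0) ger0_norm//.
by rewrite subr_ge0 (le_trans (ltW w0))// sumr_ge0.
Qed.

Section dual_series.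
Context {R : realType} {X : normedModType R} (a : ell1 R) (psi : nat -> dual X).
Hypothesis psi1 : forall k, `|psi k| <= 1.

Lemma series_block_le (b : nat -> R) (M : R) n N : (n <= N)%N -> 0 <= M ->
  (forall k, `|b k| <= M) ->
  `|\sum_(n <= k < N) a k * b k| <= (`|a| - \sum_(0 <= k < n) `|a k|) * M.
Proof.
move=> nN M0 bM; rewrite (le_trans (ler_norm_sum _ _ _))//.
rewrite (@le_trans _ _ ((\sum_(n <= k < N) `|a k|) * M))//.
  by rewrite mulr_suml; apply: ler_sum => k _; rewrite normrM ler_wpM2l.
rewrite ler_wpM2r// lerBrDl (le_trans _ (ell1_norm_ge a N))//.
by rewrite [leRHS](@big_cat_nat _ _ _ n).
Qed.

Lemma is_cvg_ell1_series (b : nat -> R) (M : R) : (forall k, `|b k| <= M) ->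
  cvgn (series (fun k => a k * b k)).
Proof.
move=> bM; have M0 : 0 <= M by exact: le_trans (bM 0%N).
apply: (@normed_cvg _ R^o).
apply: (@series_le_cvg _ _ (fun k => M * `|a k|)) => [k|k|k|] /=.
- exact: normr_ge0.
- exact: mulr_ge0.
- by rewrite normrM mulrC ler_wpM2r.
- exact: is_cvg_seriesZ (ell1P a).
Qed.

Lemma ell1_series_tail (b : nat -> R) (M : R) n l : (forall k, `|b k| <= M) ->
  series (fun k => a k * b k) @ \oo --> (l : R) ->
  `|l - \sum_(0 <= k < n) a k * b k| <= (`|a| - \sum_(0 <= k < n) `|a k|) * M.
Proof.
move=> bM cl; have M0 : 0 <= M by exact: le_trans (bM 0%N).
have : (fun N => `|series (fun k => a k * b k) N - \sum_(0 <= k < n) a k * b k|)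
    @ \oo --> `|l - \sum_(0 <= k < n) a k * b k|.
  by apply: cvg_norm; apply: cvgB => //; exact: cvg_cst.
move=> /cvgr_to_le; apply; near=> N.
have nN : (n <= N)%N by near: N; exact: nbhs_infty_ge.
rewrite /series/= (@big_cat_nat _ _ _ n)//= addrAC subrr add0r.
exact: series_block_le.
Unshelve. all: by end_near. Qed.

Lemma ell1_tail_small d : 0 < d ->
  exists N, forall n, (N <= n)%N -> `|a| - \sum_(0 <= k < n) `|a k| <= d.
Proof.
move=> d0; have : [series `|a n|]_n @ \oo --> (`|a| : R) by exact: ell1P.
move=> /cvgrPdist_le/(_ d d0)[N _ aN]; exists N => n /aN.
by rewrite /series/= => /(le_trans (ler_norm _)).
Qed.

Lemma dual_series : exists gam : dual X,
  [/\ forall U : dual (dual X), series (fun k => a k * U (psi k)) @ \oo --> (U gam : R),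
      forall n, `|gam - \sum_(0 <= k < n) a k *: psi k| <= `|a| - \sum_(0 <= k < n) `|a k|
    & forall n, `|gam - a n *: psi n| <= `|a| - `|a n|].
Proof.
have pM x k : `|psi k x| <= `|x|.
  by rewrite (le_trans (le_dual_norm _ _))// ler_piMl.
pose G x : R^o := limn (series (fun k => a k * psi k x)).
have GP x : series (fun k => a k * psi k x) @ \oo --> G x.
  exact: (is_cvg_ell1_series (pM x)).
have Gl : linear G.
  move=> t x y.
  have : (fun n => t * series (fun k => a k * psi k x) n
      + series (fun k => a k * psi k y) n) @ \oo --> t * G x + G y.
    by apply: cvgD; [apply: cvgMl_tmp|].
  move/(@cvg_lim _ (@norm_hausdorff _ _)) => <-.
  rewrite /G; congr (limn _); apply/funext => n.
  rewrite /series/= mulr_sumr -big_split/=; apply: eq_bigr => k _.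
  by rewrite linearD /= dual_linearZ; ring.
pose Gp : {linear X -> R^o} := HB.pack G (GRing.isLinear.Build R X R^o *:%R G Gl).
have GM x : `|Gp x| <= `|a| * `|x|.
  have := ell1_series_tail 0 (pM x) (GP x).
  by rewrite !big_geq// !subr0.
have [gam gamE] := exists_dual GM.
have gamS x : series (fun k => a k * psi k x) @ \oo --> (gam x : R).
  by rewrite gamE; exact: GP.
have tail n : `|gam - \sum_(0 <= k < n) a k *: psi k| <= `|a| - \sum_(0 <= k < n) `|a k|.
  apply: dual_norm_le => [|x]; first by rewrite subr_ge0 ell1_norm_ge.
  rewrite dualBE dual_sumE.
  by have := ell1_series_tail n (pM x) (gamS x).
exists gam; split=> // [U|n].
  apply/cvgrPdist_le => d d0.
  have [N aN] := ell1_tail_small (divr_gt0 d0 (ltr_wpDl (normr_ge0 U) ltr01)).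
  near=> n; have -> : U gam - series (fun k => a k * U (psi k)) n
      = U (gam - \sum_(0 <= k < n) a k *: psi k).
    have -> : series (fun k => a k * U (psi k)) n
        = U (\sum_(0 <= k < n) a k *: psi k).
      by rewrite linear_sum /series/=; apply: eq_bigr => k _; rewrite /= dual_linearZ.
    by rewrite [RHS]linearB.
  rewrite (le_trans (le_dual_norm _ _))//.
  have nN : (N <= n)%N by near: n; exact: nbhs_infty_ge.
  rewrite (le_trans (ler_wpM2l (normr_ge0 _) (le_trans (tail n) (aN n nN))))//.
  rewrite mulrCA ler_piMr ?(ltW d0)// ler_pdivrMr ?ltr_wpDl// mul1r lerDl//.
apply/ler_addgt0Pr => d d0; have [N aN] := ell1_tail_small d0.
pose K := maxn N n.+1.
have -> : gam - a n *: psi n = (gam - \sum_(0 <= k < K) a k *: psi k)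
    + (\sum_(0 <= k < K) a k *: psi k - a n *: psi n) by rewrite subrKA.
have nK : (n < K)%N by rewrite /K; exact: leq_maxr.
rewrite (le_trans (ler_normD _ _))// addrC lerD//.
  rewrite (big_nat_remove _ nK) addrAC subrr add0r (le_trans (ler_norm_sum _ _ _))//.
  rewrite lerBrDl (le_trans _ (ell1_norm_ge a K))// [leRHS](big_nat_remove _ nK) lerD2l.
  by apply: ler_sum => k _; rewrite normrZ ler_piMr.
by rewrite (le_trans (tail K))// aN// leq_maxl.
Unshelve. all: by end_near. Qed.

End dual_series.

(** * Extending the nested systems by one vector *)

Section inductive_step.
Context {R : realType} {X : completeNormedModType R} (e : nat -> dual X).
Hypothesis eb : ell1_basis e.

(** Every signed sum of the [x i] lies in the unit ball, and the best signs for [f] produce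
    [sum_i |f (x i)|]. *)
Lemma basis_sum_le n (x : 'I_n -> X) (f : dual X) :
  (forall j, \sum_i `|e j (x i)| <= 1) -> \sum_i `|f (x i)| <= `|f|.
Proof.
move=> xe; have := @signed_sum_le R n (fun i => f (x i)) 0 `|f|.
rewrite normr0 addr0; apply => s.
have -> : \sum_i (-1) ^+ s i * f (x i) + 0 = f (\sum_i (-1) ^+ s i *: x i).
  by rewrite addr0 linear_sum; apply: eq_bigr => i _ /=; rewrite dual_linearZ.
rewrite (le_trans (le_dual_norm _ _))// ler_piMr//; apply: (basis_norm_le eb) => // j.
rewrite linear_sum (le_trans (ler_norm_sum _ _ _))// (le_trans _ (xe j))//.
by apply: ler_sum => i _ /=; rewrite dual_linearZ normrM normrX normrN1 expr1n mul1r.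
Qed.

Variables (m : nat -> nat) (N0 : nat) (ga alpha beta : ell1 R) (g gal gbe : dual X).
Hypothesis m_inj : injective m.
Hypothesis mN0 : forall k, (N0 <= m k)%N.
Hypothesis gE : forall U : dual (dual X),
  series (fun j => ga j * U (e j)) @ \oo --> (U g : R).
Hypothesis galE : forall U : dual (dual X),
  series (fun k => alpha k * U (e (m k))) @ \oo --> (U gal : R).
Hypothesis gbeE : forall U : dual (dual X),
  series (fun k => beta k * U (e (m k))) @ \oo --> (U gbe : R).
Hypothesis gbe_le : forall n, `|gbe - beta n *: e (m n)| <= `|beta| - `|beta n|.
Hypothesis betaE : forall k, beta k = alpha k - ga (m k).
Let G := \sum_(0 <= j < N0) `|ga j|.
Hypothesis betaG : `|beta| < G.

Let h : dual X := g - gal.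
Let ff j : dual X := e j - (Num.sg (ga j) / G) *: gbe.

(* The last clause says that on the vectors [x i] each [e j] with [j < N0] almost acts as [sg (ga j) / G] times [gbe], which has norm [|beta| / G < 1]; this leaves room for the next vector at these coordinates. *)
Definition step_invariant n (kap : R) (x : nat -> X) :=
  [/\ forall j, \sum_(i < n) `|e j (x i)| <= 1,
      forall i k, (i < n)%N -> (k < n)%N -> e (m k) (x i) = (i == k)%:R,
      forall i, (i < n)%N -> h (x i) = 0
    & forall j, (j < N0)%N -> \sum_(i < n) `|ff j (x i)| <= kap].

Lemma eventually_constant_lim (u : nat -> R) (l c : R) K : u @ \oo --> l ->
  (forall n, (K <= n)%N -> u n = c) -> l = c.
Proof.
move=> ul uc; apply: (@cvg_unique _ (@norm_hausdorff _ R^o) _ _ _ _ ul).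
by apply: cvg_near_cst; near=> n; apply/uc; near: n; exact: nbhs_infty_ge.
Unshelve. all: by end_near. Qed.

Lemma subsequence_series_eval (a : ell1 R) (f : dual X) (U : dual (dual X)) n :
  (forall V : dual (dual X), series (fun k => a k * V (e (m k))) @ \oo --> (V f : R)) ->
  (forall k, U (e (m k)) = (k == n)%:R) -> U f = a n.
Proof.
move=> aE Um; apply: (eventually_constant_lim (K := n.+1) (aE U)) => K nK.
rewrite /series/= (big_nat_remove _ nK) Um eqxx mulr1 big1 ?addr0// => k.
by move=> /negbTE kn; rewrite Um kn mulr0.
Qed.

(** The old vectors become [x i - a i *: v]. For [j < N0] write [s] for the sign of [ga j]. Then
    [e j (x i)] is close to [s / G * gbe (x i)], and the bidual model of [v] has the value
    [s * beta n / G]; the corrected values are thus close to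
    [s / G * (gbe - beta n *: e (m n)) (x i)] and sum to about [(|beta| - |beta n|) / G] at most.
    Adding [|beta n| / G] for [v] restores the total [|beta| / G], and the error [kap] fits into the
    remaining room. *)
Lemma inductive_step n kap kap' x :
  step_invariant n kap x -> kap < kap' -> kap < 1 - `|beta| / G ->
  exists2 x', step_invariant n.+1 kap' x' &
    forall i, (i < n)%N -> x i = x' i + e (m n) (x i) *: x' n.
Proof.
move=> [x1 x2 x3 x4] kk kgap.
have G0 : 0 < G by rewrite (le_lt_trans _ betaG).
pose a i := e (m n) (x i).
have a1 : \sum_(i < n) `|a i| <= 1 by exact: x1.
(* The slack is halved because a deviation of [t] from [t0] is paid for twice: in the corrections
   [a i * t] and in the new vector. *)
pose del := (1 - `|beta| / G - kap) / 2.
have del0 : 0 < del by rewrite divr_gt0// subr_gt0.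
(* The bidual solution: [1] at [m n], and multiples of [sg (ga j)] for [j < N0]; it kills [h] exactly when [t = t0]. *)
pose t0 := beta n / G.
pose bb t j := if (j < N0)%N then Num.sg (ga j) * t else (j == m n)%:R.
have sg1 (c : R) : `|Num.sg c| <= 1 by rewrite normr_sg; case: (_ != 0).
have bbM t j : `|bb t j| <= `|t| + 1.
  rewrite /bb; case: ifP => _.
    by rewrite normrM (le_trans (ler_piMl _ (sg1 _)))// lerDl.
  by case: (_ == _); rewrite ?normr1 ?normr0 ?addr_ge0// lerDr.
have bbm t k : bb t (m k) = (k == n)%:R.
  by rewrite /bb ltnNge mN0/= inj_eq.
have basisU t : exists U : dual (dual X), forall j, U (e j) = bb t j.
  by have [_ _ H] := eb; exact: (H _ _ (bbM t)).
have Ug t (U : dual (dual X)) : (forall j, U (e j) = bb t j) -> (U g : R) = G * t + ga (m n).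
  move=> UE; apply: (eventually_constant_lim (K := (m n).+1) (@gE U)) => K nK.
  have NK : (N0 <= K)%N by rewrite (leq_trans (mN0 n)) ?(ltnW nK).
  rewrite /series/= (@big_cat_nat _ _ _ N0)//=; congr (_ + _).
    rewrite mulr_suml; apply: eq_big_nat => j /andP[_ jN].
    by rewrite UE /bb jN mulrA [_ * Num.sg _]mulrC -normrEsg.
  rewrite (bigD1_seq (m n)) ?iota_uniq//=; last by rewrite mem_index_iota mN0 nK.
  rewrite UE bbm eqxx mulr1 big_seq_cond big1 ?addr0// => j.
  rewrite mem_index_iota => /andP[/andP[Nj _] jm].
  by rewrite UE /bb ltnNge Nj/= (negbTE jm) mulr0.
have Uh t (U : dual (dual X)) : (forall j, U (e j) = bb t j) -> U h = G * (t - t0).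
  move=> UE; rewrite linearB /= (Ug t)// (@subsequence_series_eval alpha gal U n)//; last first.
    by move=> k; rewrite UE bbm.
  have -> : alpha n = beta n + ga (m n) by rewrite betaE subrK.
  by rewrite mulrBr [G * t0]mulrC divfK ?gt_eqF//; ring.
have room t j : `|t - t0| <= del ->
    \sum_(i < n) `|e j (x i) - a i * bb t j| + `|bb t j| <= 1.
  move=> tdel; rewrite /bb; case: ifPn => jN; last first.
    have [->|_] := eqVneq j (m n).
      by rewrite /= normr1 big1 ?add0r// => i _; rewrite mulr1 subrr normr0.
    by rewrite normr0 addr0; under eq_bigr do rewrite mulr0 subr0; exact: x1.
  have nsg (c : R) : `|Num.sg (ga j) * c| <= `|c|.
    by rewrite normrM (le_trans (ler_piMl _ (sg1 _))).
  have tt0 : `|t| <= `|t0| + del.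
    by rewrite -[t](subrK t0) (le_trans (ler_normD _ _))// addrC lerD2l.
  have xE i : e j (x i) - a i * (Num.sg (ga j) * t) = ff j (x i)
      + (Num.sg (ga j) / G * (gbe - beta n *: e (m n)) (x i)
      - Num.sg (ga j) * (a i * (t - t0))).
    rewrite /ff !dualBE !dualZE -/(a i) /t0.
    by field; rewrite gt_eqF.
  have : \sum_(i < n) `|e j (x i) - a i * (Num.sg (ga j) * t)| <=
      kap + ((`|beta| - `|beta n|) / G + del).
    rewrite (le_trans _ (lerD (x4 j jN) (lerD
      (_ : \sum_(i < n) `|(gbe - beta n *: e (m n)) (x i)| / G <= _)
      (_ : \sum_(i < n) `|a i| * del <= _))))//.
    - rewrite -!big_split/=; apply: ler_sum => i _; rewrite xE.
      rewrite (le_trans (ler_normD _ _))// lerD2l (le_trans (ler_normB _ _))//.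
      rewrite lerD//.
        by rewrite -mulrA (le_trans (nsg _))// normrM mulrC (@gtr0_norm _ G^-1) ?invr_gt0.
      by rewrite (le_trans (nsg _))// normrM ler_wpM2l.
    - rewrite -mulr_suml ler_wpM2r ?invr_ge0 ?(ltW G0)// (le_trans _ (gbe_le n))//.
      exact: basis_sum_le.
    - by rewrite -mulr_suml ler_piMl// ltW.
  have : `|Num.sg (ga j) * t| <= `|beta n| / G + del.
    rewrite (le_trans (nsg _))// (le_trans tt0)// /t0 normrM (@ger0_norm _ G^-1)//.
    by rewrite invr_ge0 ltW.
  have : kap + ((`|beta| - `|beta n|) / G + del) + (`|beta n| / G + del) = 1.
    by rewrite /del; field; rewrite gt_eqF.
  lra.
(* The requirement on [v] is [|XS s - cs s *: v| <= 1] for all sign choices [s]; when [cs s = 0] it is void and the unit ball serves as a harmless substitute. *)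
pose S := {ffun 'I_n -> bool}.
pose XS (s : S) := \sum_i (-1) ^+ s i *: x i.
pose cs (s : S) := \sum_i (-1) ^+ s i * a i - 1.
pose y s := if cs s == 0 then 0 else (cs s)^-1 *: XS s.
pose r s := if cs s == 0 then 1 else `|cs s|^-1.
have r0 s : 0 <= r s by rewrite /r; case: ifP => // _; rewrite invr_ge0.
have XSe (f : dual X) s : f (XS s) = \sum_i (-1) ^+ s i * f (x i).
  by rewrite linear_sum; apply: eq_bigr => i _ /=; rewrite dual_linearZ.
have XSt (f : dual X) (s : S) t : \sum_i (-1) ^+ s i * (f (x i) - a i * t) + t
    = f (XS s) - cs s * t.
  rewrite XSe /cs mulrBl mul1r opprB addrA mulr_suml addrAC -sumrB.
  by congr (_ + _); apply: eq_bigr => i _; ring.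
have sgn_le (s : S) (z : 'I_n -> R) t :
    `|\sum_i (-1) ^+ s i * z i + t| <= \sum_i `|z i| + `|t|.
  rewrite (le_trans (ler_normD _ _))// lerD2r (le_trans (ler_norm_sum _ _ _))//.
  by apply: ler_sum => i _; rewrite normrM normrX normrN1 expr1n mul1r.
have inball t (U : dual (dual X)) : `|t - t0| <= del ->
    (forall j, U (e j) = bb t j) ->
    forall s j, `|U (e j) - e j (y s)| <= r s.
  move=> tdel UE s j; rewrite UE /y /r.
  have rm := room t j tdel; case: ifPn => [_|c0].
    rewrite linear0 subr0 (le_trans _ rm)// lerDr sumr_ge0//.
  have := le_trans (sgn_le s _ _) rm; rewrite XSt dual_linearZ => H.
  have -> : bb t j - (cs s)^-1 * e j (XS s) = (cs s)^-1 * - (e j (XS s) - cs s * bb t j).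
    by field.
  by rewrite normrM normrN normfV ler_piMr.
(* By [Uh], shifting [t0] by [del] either way gives [h] the values [- G * del] and [G * del], while
   the values at the [e (m k)] stay the same. *)
have [U0 U0E] := basisU t0; have [Um UmE] := basisU (t0 - del).
have [Up UpE] := basisU (t0 + del).
(* One half of the increase of [kap] pays for [ff j v] itself, the other for the corrections, where
   [sum_i |a i| <= 1]. *)
have rho0 : 0 < (kap' - kap) / 2 by rewrite divr_gt0// subr_gt0.
have [U||||v [v1 v2 v3 v4]] := @exact_interpolation R X e eb S [ffun=> true] y r
    [seq m k | k <- iota 0 n.+1] h [seq ff j | j <- iota 0 N0] U0 Um Up
    ((kap' - kap) / 2) r0 rho0.
- have del1 (d : R) : `|d| <= del -> `|t0 + d - t0| <= del by rewrite addrAC subrr add0r.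
  have Jm t (U' : dual (dual X)) : (forall j, U' (e j) = bb t j) ->
      forall j, j \in [seq m k | k <- iota 0 n.+1] -> U' (e j) = U0 (e j).
    by move=> U'E _ /mapP[k _ ->]; rewrite U'E U0E !bbm.
  case=> ->; split.
  + by apply: (inball _ _ _ U0E); rewrite subrr normr0 ltW.
  + exact: Jm U0E.
  + by apply: (inball _ _ _ UmE); apply: del1; rewrite normrN gtr0_norm.
  + exact: Jm UmE.
  + by apply: (inball _ _ _ UpE); apply: del1; rewrite gtr0_norm.
  + exact: Jm UpE.
- by rewrite (Uh _ _ UmE) addrAC subrr add0r pmulr_rlt0// oppr_lt0.
- by rewrite (Uh _ _ UpE) addrAC subrr add0r mulr_gt0.
- by rewrite (Uh _ _ U0E) subrr mulr0.
have vm k : (k <= n)%N -> e (m k) v = (k == n)%:R.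
  move=> kn; rewrite v2 ?U0E ?bbm//; apply: map_f; by rewrite mem_iota.
have vff j : (j < N0)%N -> `|ff j v| <= (kap' - kap) / 2.
  move=> jN; have := v4 (ff j); rewrite map_f ?mem_iota// => /(_ isT).
  suff -> : U0 (ff j) = 0 by rewrite subr0.
  rewrite linearB /= dual_linearZ U0E (@subsequence_series_eval beta gbe U0 n)//.
    by rewrite /bb jN /t0 mulrA mulrAC subrr.
  by move=> k; rewrite U0E bbm.
pose x' i := if (i < n)%N then x i - a i *: v else v.
have x'n : x' n = v by rewrite /x' ltnn.
have x'i (i : 'I_n) : x' i = x i - a i *: v by rewrite /x' ltn_ord.
exists x'; last by move=> i ilt; rewrite x'n /x' ilt subrK.
split.
- move=> j; rewrite big_ord_recr /= x'n; apply: signed_sum_le => s.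
  under eq_bigr do rewrite x'i linearB /= dual_linearZ.
  rewrite XSt; have -> : e j (XS s) - cs s * e j v = e j (XS s - cs s *: v).
    by rewrite linearB /= dual_linearZ.
  rewrite (le_trans (basis_val_le eb _ _))//.
  have := v1 s; rewrite /y /r; case: ifPn => [/eqP -> _|c0 H].
    rewrite scale0r subr0; apply: (basis_norm_le eb) => // k.
    rewrite XSe; have := sgn_le s (fun i => e k (x i)) 0.
    by rewrite normr0 !addr0 => /le_trans; apply.
  have -> : XS s - cs s *: v = - cs s *: (v - (cs s)^-1 *: XS s).
    by rewrite scalerBr scalerA mulNr divff// !scaleNr scale1r opprK addrC.
  rewrite normrZ normrN -ler_pdivlMl ?normr_gt0// mulr1//.
- move=> i k; rewrite !ltnS => ilt klt; rewrite /x'.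
  case: ltnP => iln; last first.
    have -> : i = n by apply/eqP; rewrite eqn_leq ilt.
    by rewrite vm// eq_sym.
  rewrite dual_linearBZ vm//; have [->|kn] := eqVneq k n.
    by rewrite mulr1 subrr (ltn_eqF iln).
  by rewrite mulr0 subr0 x2// ltn_neqAle kn.
- move=> i; rewrite ltnS /x' => ilt; case: ltnP => // iln.
  by rewrite dual_linearBZ v3 mulr0 subr0 x3.
- move=> j jN; rewrite big_ord_recr /= x'n.
  have : \sum_(i < n) `|ff j (x' i)| <= kap + (kap' - kap) / 2.
    rewrite (@le_trans _ _ (\sum_(i < n) (`|ff j (x i)| + `|a i| * `|ff j v|)))//.
      apply: ler_sum => i _; rewrite x'i dual_linearBZ -normrM.
      exact: ler_normB.
    rewrite big_split/= lerD ?x4// -mulr_suml (le_trans _ (vff j jN))//.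
    by rewrite ler_piMl.
  have := vff j jN; lra.
Qed.

End inductive_step.

(** * Weak-star convergent sequences of extreme points *)

Section ell1_sequences.
Context {R : realType}.

Lemma ell1_exists (u : nat -> R) M : (forall n, \sum_(0 <= k < n) `|u k| <= M) ->
  exists2 a : ell1 R, forall k, a k = u k & `|a| <= M.
Proof.
move=> uM; have nd : nondecreasing_seq [series `|u n|]_n.
  by apply/nondecreasing_seqP => n; rewrite /series/= big_nat_recr//= lerDl.
have cu : cvgn [series `|u n|]_n.
  by apply: nondecreasing_is_cvgn => //; exists M => _ [n _ <-]; exact: uM.
have ue : (u : nat -> R^o) \in @in_ell1 R by apply/asboolP.
exists (Ell1 ue) => //; apply: (cvgr_to_le cu); apply: nearW => n; exact: uM.
Qed.

Lemma ell1_eqP (a b : ell1 R) : (forall k, a k = b k) -> a = b.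
Proof. by move=> ab; apply/val_inj/funext. Qed.

Lemma ell1BE (a b : ell1 R) k : (a - b) k = a k - b k. Proof. by []. Qed.
Lemma ell1DE (a b : ell1 R) k : (a + b) k = a k + b k. Proof. by []. Qed.
Lemma ell1ZE (t : R) (a : ell1 R) k : (t *: a) k = t * a k. Proof. by []. Qed.

Lemma ell1_norm_le (a : ell1 R) M :
  (forall n, \sum_(0 <= k < n) `|a k| <= M) -> `|a| <= M.
Proof.
by move=> aM; have [b ab] := ell1_exists aM; rewrite (ell1_eqP ab).
Qed.

End ell1_sequences.

Section basis_of_isometry.
Context {R : realType} {X : normedModType R}.

(** [e j] is the preimage of the [j]-th unit vector. Subtracting a partial sum from [f] deletes the
    first coordinates of [T f], whence norm convergence; a bounded [b] acts by
    [f |-> sum_k (T f)_k b_k]. *)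
Lemma ell1_basis_of_isometry :
  linearly_isometric [set: dual X] [set: ell1 R] ->
  exists e : nat -> dual X, ell1_basis e.
Proof.
move=> [T [[_ Tinj Tsurj] Tlin Tnorm]].
have Tl (c : R) f g : T (c *: f + g) = c *: T f + T g by exact: Tlin.
have Tsub (f g : dual X) : T (f - g) = T f - T g.
  by rewrite addrC -scaleN1r Tl scaleN1r addrC.
have Tn f : `|T f| = `|f| by exact: Tnorm.
have /choice[dl dlP] : forall j, exists d : ell1 R, forall k, d k = (k == j)%:R.
  move=> j; have [n|d dE _] := @ell1_exists R (fun k => (k == j)%:R) 1.
    have [jn|nj] := ltnP j n.
      rewrite (bigD1_seq j) ?mem_index_iota ?iota_uniq//= eqxx normr1 big1 ?addr0//.
      by move=> k /negbTE ->; rewrite normr0.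
    rewrite big_nat big1 ?ler01// => k /andP[_ kn].
    by rewrite ltn_eqF ?normr0// (leq_trans kn).
  by exists d.
have /choice[e eP] : forall j, exists f : dual X, T f = dl j.
  by move=> j; have [f _ fE] := Tsurj (dl j) I; exists f.
have partial (f : dual X) n k : (T (f - \sum_(0 <= j < n) T f j *: e j)) k
    = if (k < n)%N then 0 else T f k.
  elim: n => [|n IH]; first by rewrite big_geq// subr0.
  rewrite big_nat_recr//= opprD addrA Tsub ell1BE IH.
  have -> : T (T f n *: e n) k = T f n * (k == n)%:R.
    have T0 : T 0 = 0 by have := Tsub 0 0; rewrite !subrr.
    by rewrite -[_ *: e n]addr0 Tl T0 addr0 ell1ZE eP dlP.
  rewrite ltnS [(k <= n)%N]leq_eqVlt; have [->|kn] := eqVneq k n; rewrite ?ltnn /=.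
    by rewrite mulr1 subrr.
  by rewrite mulr0 subr0.
have partial_norm (f : dual X) n :
    `|f - \sum_(0 <= j < n) T f j *: e j| <= `|T f| - \sum_(0 <= j < n) `|T f j|.
  rewrite -Tn; apply: ell1_norm_le => K.
  rewrite lerBrDl; have := ell1_norm_ge (T f) (maxn n K).
  rewrite (@big_cat_nat _ _ _ n) ?leq_maxl//; apply: le_trans; rewrite lerD2l.
  have [nK|Kn] := leqP n K.
    rewrite [leLHS](@big_cat_nat _ _ _ n)//= big_nat big1 ?add0r.
      apply: ler_sum_nat => k /andP[nk kK].
      by rewrite partial ltnNge nk.
    by move=> k /andP[_ kn]; rewrite partial kn normr0.
  rewrite [leLHS]big_nat [leLHS]big1 ?sumr_ge0// => k /andP[_ kK].
  by rewrite partial (ltn_trans kK Kn) normr0.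
exists e; split.
- move=> j; rewrite -Tn eP; apply: ell1_norm_le => n.
  under eq_bigr do rewrite dlP.
  have [jn|nj] := ltnP j n.
    rewrite (bigD1_seq j) ?mem_index_iota ?iota_uniq//= eqxx normr1 big1 ?addr0//.
    by move=> k /negbTE ->; rewrite normr0.
  rewrite big_nat big1 ?ler01// => k /andP[_ kn].
  by rewrite ltn_eqF ?normr0// (leq_trans kn).
- move=> f; exists (T f) => // U; apply/cvgrPdist_le => d d0.
  have [N aN] := ell1_tail_small (T f) (divr_gt0 d0 (ltr_wpDl (normr_ge0 U) ltr01)).
  near=> n; have nN : (N <= n)%N by near: n; exact: nbhs_infty_ge.
  have -> : series (fun k => T f k * U (e k)) n
      = U (\sum_(0 <= k < n) T f k *: e k).
    by rewrite linear_sum /series/=; apply: eq_bigr => k _; rewrite /= dual_linearZ.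
  have -> : U f - U (\sum_(0 <= k < n) T f k *: e k)
      = U (f - \sum_(0 <= k < n) T f k *: e k) by rewrite [RHS]linearB.
  rewrite (le_trans (le_dual_norm _ _))//.
  rewrite (le_trans (ler_wpM2l (normr_ge0 _) (le_trans (partial_norm f n) (aN n nN))))//.
  by rewrite mulrCA ler_piMr ?(ltW d0)// ler_pdivrMr ?ltr_wpDl// mul1r lerDl.
- move=> b M bM; have M0 : 0 <= M by exact: le_trans (bM 0%N).
  pose V (f : dual X) : R^o := limn (series (fun k => T f k * b k)).
  have VP f : series (fun k => T f k * b k) @ \oo --> V f.
    exact: (is_cvg_ell1_series bM).
  have Vl : linear V.
    move=> t f g.
    have : (fun n => t * series (fun k => T f k * b k) n
        + series (fun k => T g k * b k) n) @ \oo --> t * V f + V g.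
      by apply: cvgD; [apply: cvgMl_tmp|].
    move/(@cvg_lim _ (@norm_hausdorff _ _)) => <-.
    rewrite /V; congr (limn _); apply/funext => n.
    rewrite /series/= mulr_sumr -big_split/=; apply: eq_bigr => k _.
    by rewrite Tl ell1DE ell1ZE; ring.
  pose Vp : {linear dual X -> R^o} :=
    HB.pack V (GRing.isLinear.Build R (dual X) R^o *:%R V Vl).
  have VM f : `|Vp f| <= M * `|f|.
    have := ell1_series_tail 0 bM (VP f).
    by rewrite !big_geq// !subr0 Tn mulrC.
  have [U UE] := exists_dual VM; exists U => j.
  rewrite UE; apply: (@cvg_unique _ (@norm_hausdorff _ R^o) _ _ _ _ (VP (e j))).
  apply: cvg_near_cst; near=> n.
  have jn : (j < n)%N by near: n; exact: nbhs_infty_gt.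
  rewrite /series/= (bigD1_seq j) ?mem_index_iota ?iota_uniq//= eP dlP eqxx mul1r.
  by rewrite big1 ?addr0// => k /negbTE kj; rewrite dlP kj mul0r.
Unshelve. all: by end_near. Qed.

End basis_of_isometry.

(** * Extreme points of the dual ball and separability *)

Section extreme_points_of_dual.
Context {R : realType} {X : completeNormedModType R} (e : nat -> dual X).
Hypothesis eb : ell1_basis e.

Lemma basis_expansion (f : dual X) : exists a : ell1 R, [/\ `|f| = `|a|,
  forall U : dual (dual X), series (fun k => a k * U (e k)) @ \oo --> (U f : R),
  forall n, `|f - \sum_(0 <= k < n) a k *: e k| <= `|a| - \sum_(0 <= k < n) `|a k|
  & forall n, `|f - a n *: e n| <= `|a| - `|a n|].
Proof.
have [e1 /(_ f)[a fa aU] _] := eb; exists a.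
have [gam [gamU gam_tail gam_coord]] := dual_series a e1.
suff fg : f = gam by split=> //; rewrite fg.
apply: dual_eqP => x; have [V VE] := exists_bidual_eval x.
rewrite -!VE; exact: (@cvg_unique _ (@norm_hausdorff _ R^o) _ _ _ _ (aU V) (gamU V)).
Qed.

(** If [0 < |a i| < 1], then [f] is a convex combination of [sg (a i) *: e i] and the normalized
    rest, with weights [|a i|] and [1 - |a i|], so extremality identifies it with the former; if
    [|a i| >= 1], the rest vanishes. And 0 is the midpoint of [e 0] and [- e 0], hence not
    extreme. *)
Lemma extreme_point_basis (f : dual X) : extreme_points (unit_ball (dual X)) f ->
  exists j (s : bool), f = (-1) ^+ s *: e j.
Proof.
move=> [f1 fext]; have [a [fa aU _ acoord]] := basis_expansion f.
have ball_e j (c : R) : `|c| <= 1 -> unit_ball (dual X) (c *: e j).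
  by move=> c1; have [e1 _ _] := eb; rewrite /unit_ball/= normrZ mulr_ile1.
have [[i ai0]|/forallNP a0] := pselect (exists i, a i != 0); last first.
  have f0 : f = 0.
    apply/normr0_eq0/eqP; rewrite fa -normr_le0 normr_id; apply: ell1_norm_le => n.
    rewrite big1// => k _; have /negP := a0 k; rewrite negbK => /eqP ->.
    exact: normr0.
  have n1 : `|1 : R| <= 1 by rewrite normr1.
  have nN1 : `|- 1 : R| <= 1 by rewrite normrN1.
  have [||e00 _] := fext _ _ (2^-1) (ball_e 0%N _ n1) (ball_e 0%N _ nN1).
  - by rewrite invr_gt0 ltr0n invf_lt1// ltr1n.
  - by rewrite f0 scale1r scaleN1r scalerN -scalerBl (_ : 2^-1 - (1 - 2^-1) = 0) ?scale0r//; lra.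
  have [_ _ /(_ (fun=> 1) 1)[|U /(_ 0%N)]] := eb; first by move=> j; rewrite normr1.
  by move: e00; rewrite f0 scale1r => ->; rewrite linear0 => /esym/eqP; rewrite oner_eq0.
have t0 : 0 < `|a i| by rewrite normr_gt0.
have fi : `|f - a i *: e i| <= 1 - `|a i|.
  by rewrite (le_trans (acoord i))// lerD2r -fa.
have ae : a i *: e i = `|a i| *: (Num.sg (a i) *: e i).
  by rewrite scalerA mulrC -numEsg.
have sgE : Num.sg (a i) = (-1) ^+ (a i < 0)%R.
  by rewrite -[LHS]mul1r; case: sgrP ai0; rewrite ?eqxx// ?expr0 ?expr1 ?mul1r.
exists i, (a i < 0)%R; rewrite -sgE.
have [ai1|] := ltP `|a i| 1.
  have [||||<- _ //] := fext (Num.sg (a i) *: e i) ((1 - `|a i|)^-1 *: (f - a i *: e i)) `|a i|.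
  - by apply: ball_e; rewrite normr_sg ai0.
  - rewrite /unit_ball/= normrZ normfV gtr0_norm ?subr_gt0//.
    by rewrite ler_pdivrMl ?subr_gt0// mulr1.
  - by rewrite t0.
  - by rewrite -ae scalerA divff ?gt_eqF ?subr_gt0// scale1r addrC subrK.
move=> ai1; have : `|f - a i *: e i| <= 0 by rewrite (le_trans fi)// subr_le0.
rewrite normr_le0 subr_eq0 => /eqP ->; rewrite ae.
suff -> : `|a i| = 1 by rewrite scale1r.
apply/eqP; rewrite eq_le ai1 andbT.
by have := le_trans (normr_ge0 _) fi; rewrite subr_ge0.
Qed.

Lemma dual_norm_half (f : dual X) : exists x, `|x| <= 1 /\ `|f| / 2 <= f x.
Proof.
have [->|f0] := eqVneq f 0; first by exists 0; rewrite !normr0 mul0r ler01 linear0.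
have d0 : 0 < `|f| / 2 by rewrite divr_gt0// normr_gt0.
have hs : has_sup [set `|f t| | t in unit_ball X].
  split; first by exists `|f 0|, 0 => //; rewrite /unit_ball/= normr0.
  by have [M fM] := dual_bounded f; exists M => _ [t tb <-]; exact: fM.
have [_ [x xb <-] fx] := sup_adherent d0 hs.
have {}fx : `|f| / 2 <= `|f x|.
  move: fx; rewrite -/(supnorm (unit_ball X) f) -[supnorm _ _]/(`|f|); lra.
have [fx0|fx0] := leP 0 (f x); first by exists x; split=> //; rewrite -[leRHS]ger0_norm.
by exists (- x); rewrite normrN linearN -[- f x]ltr0_norm.
Qed.

(* [D] consists of vectors that almost norm the rational combinations of the basis. *)
Lemma weak_star_separable : exists D : nat -> X,
  forall (phi : nat -> dual X) (g : dual X), (forall k, `|phi k| <= 1) ->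
  (forall l, (fun k => phi k (D l)) @ \oo --> (g (D l) : R)) ->
  forall x, (fun k => phi k x) @ \oo --> (g x : R).
Proof.
pose fs (s : seq rat) : dual X := \sum_(0 <= i < size s) ratr (nth 0 s i) *: e i.
have /choice[D0 D0P] : forall s, exists x, `|x| <= 1 /\ `|fs s| / 2 <= fs s x.
  by move=> s; exact: dual_norm_half.
pose D n := if unpickle n is Some s then D0 s else 0.
have Dtotal (f : dual X) : (forall n, f (D n) = 0) -> f = 0.
  move=> fD; apply/eqP; rewrite -normr_le0; apply/ler_addgt0Pr => d d0.
  have [a [fa _ atail _]] := basis_expansion f.
  (* One sixth is for truncation, one for rational rounding. As [f] is within [d / 3] of [fs s] and
     vanishes at [D0 s], the norm of [fs s] is at most [2 * d / 3], so [|f| <= d]. *)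
  have d6 : 0 < d / 6 by rewrite divr_gt0.
  have [N /(_ N (leqnn N)) aN] := ell1_tail_small a d6.
  have dN : 0 < d / 6 / N.+1%:R by rewrite divr_gt0.
  have /choice[q qP] : forall i, exists q : rat, `|a i - ratr q| <= d / 6 / N.+1%:R.
    move=> i; have /rat_in_itvoo[q] : a i < a i + d / 6 / N.+1%:R by rewrite ltrDl.
    by rewrite in_itv/= => /andP[q1 q2]; exists q; rewrite ler0_norm ?subr_le0 ?(ltW q1)// opprB lerBlDl (ltW q2).
  pose s := mkseq q N.
  have fsE : fs s = \sum_(0 <= i < N) ratr (q i) *: e i.
    rewrite /fs size_mkseq; apply: eq_big_nat => i /andP[_ iN].
    by rewrite nth_mkseq.
  have ffs : `|f - fs s| <= d / 6 + d / 6.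
    rewrite -(subrKA (\sum_(0 <= i < N) a i *: e i)) (le_trans (ler_normD _ _))//.
    rewrite lerD//; first exact: le_trans (atail N) aN.
    rewrite fsE -sumrB (le_trans (ler_norm_sum _ _ _))//.
    rewrite (@le_trans _ _ (\sum_(0 <= i < N) d / 6 / N.+1%:R))//.
      apply: ler_sum => i _; rewrite -scalerBl normrZ.
      have [e1 _ _] := eb; rewrite (le_trans (ler_piMr _ (e1 i)))//.
    rewrite sumr_const_nat subn0 -[_ *+ N]mulr_natr -mulrA ler_piMr ?(ltW d6)//.
    by rewrite mulrC ler_pdivrMr// mul1r ler_nat.
  have [x1 fx] := D0P s.
  have DE : D (pickle s) = D0 s by rewrite /D pickleK.
  have := fD (pickle s); rewrite DE => fD0.
  have : `|(f - fs s) (D0 s)| <= `|f - fs s|.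
    by rewrite (le_trans (le_dual_norm _ _))// ler_piMr.
  rewrite dualBE fD0 sub0r normrN => h1.
  have := ler_norm (fs s (D0 s)).
  have := ler_normD (f - fs s) (fs s); rewrite subrK; lra.
exists D => phi g phi1 phiD x.
(* If [C] approximates [x], the bound on the [phi k] carries convergence over to [x]; otherwise
   Hahn-Banach gives a nonzero functional vanishing on [C], against [Dtotal]. *)
pose C : set X := [set d | (fun k => phi k d) @ \oo --> (g d : R)].
have [Cd|nC] := pselect (forall c, 0 < c -> exists2 d, C d & `|x + d| < c).
  apply/cvgrPdist_le => c c0.
  have c3 : 0 < c / (2 * (2 + `|g|)).
    by rewrite divr_gt0// mulr_gt0// ltr_wpDr.
  have [d Cdd xd] := Cd _ c3.
  have c2 : 0 < c / 2 by rewrite divr_gt0.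
  move/cvgrPdist_le : (Cdd) => /(_ _ c2) H.
  near=> k.
  have -> : g x - phi k x = (g - phi k) (x + d) - (g d - phi k d).
    by rewrite dualBE !linearD /=; ring.
  have hk : `|g d - phi k d| <= c / 2 by near: k.
  rewrite (le_trans (ler_normB _ _))// [leRHS]splitr lerD//.
  rewrite (le_trans (le_dual_norm _ _))//.
  have gk : `|g - phi k| <= 2 + `|g|.
    by rewrite (le_trans (ler_normB _ _))// addrC lerD2r (le_trans (phi1 k))// ler1n.
  have n0 : 2 + `|g| != 0 by rewrite gt_eqF// ltr_wpDr.
  rewrite (le_trans (ler_pM _ _ gk (ltW xd)))//.
  by rewrite [leLHS](_ : _ = c / 2)//; field.
exfalso; apply: nC; apply: contrapT => /existsNP[c /not_implyP[c0 /forall2NP hc]].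
have ns : seminorm (fun z : X => `|z|).
  by split=> [u v|t u]; [exact: ler_normD|rewrite normrZ].
have [||d Cdd|f [f1 f0 fx]] := hahn_banach_annihilator (D := C) (y := x) (c := c) ns.
- by rewrite /C/= linear0; under eq_fun do rewrite linear0; exact: cvg_cst.
- move=> t u v Cu Cv; rewrite /C/= linearP.
  under eq_fun do rewrite linearP; apply: cvgD => //.
  by apply: cvgMl_tmp.
- by rewrite leNgt; apply/negP; have [] := hc d.
have fN z : `|f z| <= 1 * `|z|.
  by rewrite mul1r ler_norml f1 andbT lerNl -linearN (le_trans (f1 _))// normrN.
have [F FE] := exists_dual fN.
have F0 : F = 0 by apply: Dtotal => n; rewrite FE f0//; exact: phiD.
by move: fx; rewrite -FE F0 dual0E leNgt c0.
Unshelve. all: by end_near. Qed.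

End extreme_points_of_dual.

Lemma weak_star_nbhs (R : realType) (X : normedModType R) (g : dual X)
    (s : seq (X * R)) : (forall c, c \in s -> 0 < c.2) ->
  nbhs (g : weak_star_dual X)
    [set f : dual X | forall c, c \in s -> `|f c.1 - g c.1| < c.2].
Proof.
elim: s => [_|c s IH H].
  by apply: filterS (@filterT _ (nbhs (g : weak_star_dual X)) _) => f _ c.
have ev : (fun f : weak_star_dual X => (f : dual X) c.1 : R^o)
    @ (g : weak_star_dual X) --> (g c.1 : R^o).
  apply: (@cvg_comp _ _ _ (fun f : weak_star_dual X => (f : dual X) : {ptws X -> R^o})
    (fun h : {ptws X -> R^o} => h c.1) _ (nbhs ((g : dual X) : {ptws X -> R^o}))).
    exact: initial_continuous.
  exact: (@proj_continuous X (fun=> R^o) c.1).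
have c0 : 0 < c.2 by apply: H; rewrite inE eqxx.
have /cvgrPdistC_lt/(_ _ c0) evc := ev.
have {}IH := IH (fun c' c's => H c' (mem_behead (s := c :: s) c's)).
apply: filterS (filterI evc IH) => f /= [fc fs] c'.
by rewrite inE => /predU1P[->//|]; exact: fs.
Qed.

Lemma injective_of_increasing (m : nat -> nat) :
  (forall k, (m k < m k.+1)%N) -> injective m.
Proof.
move=> mS; have mlt i j : (i < j)%N -> (m i < m j)%N by apply: (homo_ltn ltn_trans).
move=> i j mij; have [/mlt|/mlt|//] := ltngtP i j; by rewrite mij ltnn.
Qed.

(** * Choosing the subsequence and the cutoff *)

Section selection.
Context {R : realType} {X : completeNormedModType R} (e : nat -> dual X).
Hypothesis eb : ell1_basis e.

Lemma basis_resign (sg : nat -> bool) : ell1_basis (fun j => (-1) ^+ sg j *: e j).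
Proof.
have [e1 e2 e3] := eb; split=> [j|f|b M bM].
- by rewrite normrZ normrX normrN1 expr1n mul1r.
- have [a fa aU] := e2 f.
  have na k : `|(-1) ^+ sg k * a k| = `|a k| by rewrite normrM normrX normrN1 expr1n mul1r.
  have [n|b bE _] := @ell1_exists R (fun j => (-1) ^+ sg j * a j) `|a|.
    by under eq_bigr do rewrite na; exact: ell1_norm_ge.
  exists b.
    rewrite fa; apply/eqP; rewrite eq_le; apply/andP; split; apply: ell1_norm_le => n.
      by under eq_bigr do rewrite -na -bE; exact: ell1_norm_ge.
    by under eq_bigr do rewrite bE na; exact: ell1_norm_ge.
  move=> U; suff -> : series (fun j => b j * U ((-1) ^+ sg j *: e j))
      = series (fun j => a j * U (e j)) by exact: aU.
  apply/funext => n.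
  rewrite /series/=; apply: eq_bigr => k _.
  by rewrite dual_linearZ bE mulrACA -expr2 sqrr_sign mul1r.
- have [|U UE] := e3 (fun j => (-1) ^+ sg j * b j) M.
    by move=> j; rewrite normrM normrX normrN1 expr1n mul1r.
  by exists U => j; rewrite dual_linearZ UE mulrA -expr2 sqrr_sign mul1r.
Qed.

(** A weak-star neighbourhood of [g] tests [D 0], ..., [D (L - 1)] to precision [1 / (L + 1)] and
    excludes those of the finitely many [+-e j] with [j < N] that differ from [g]. An extreme point
    in it other than [g] is some [+-e j] with [j >= N]. Convergence on [D] suffices by
    separability. *)
Lemma limit_point_selection (g : dual X) :
  weak_star_derived (extreme_points (unit_ball (dual X))) g ->
  forall N0, exists (m : nat -> nat) (sg : nat -> bool),
    [/\ forall k, (N0 <= m k)%N, forall k, (m k < m k.+1)%N &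
      forall x, (fun k => (-1) ^+ sg k * e (m k) x) @ \oo --> (g x : R)].
Proof.
move=> gd N0; have [D DP] := weak_star_separable eb.
have sel N L : exists js : nat * bool, (N <= js.1)%N /\
    forall l, (l < L)%N -> `|(-1) ^+ js.2 * e js.1 (D l) - g (D l)| < L.+1%:R^-1.
  (* [w] gives a point and a gap that separate a signed basis vector from [g]. If the two coincide,
     the void condition [(0, 1)] does, since a limit point is approached by points other than
     itself. *)
  have /choice[w wP] : forall js : nat * bool, exists xd : X * R, 0 < xd.2 /\
      ((-1) ^+ js.2 *: e js.1 != g ->
        xd.2 <= `|((-1) ^+ js.2 *: e js.1) xd.1 - g xd.1|).
    move=> [j s] /=; have [_|/negP ne] := boolP (_ == g).
      by exists (0, 1).
    have /existsNP[x xP] : ~ forall x, ((-1) ^+ s *: e j) x = g x.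
      by move=> H; apply: ne; apply/eqP/dual_eqP.
    exists (x, `|((-1) ^+ s *: e j) x - g x|); split=> //=.
    by rewrite normr_gt0 subr_eq0; apply/eqP.
  pose cs := [seq (D l, L.+1%:R^-1 : R) | l <- iota 0 L]
    ++ [seq w js | js <- [seq (j, s) | j <- iota 0 N, s <- [:: true; false]]].
  have cs0 c : c \in cs -> 0 < c.2.
    rewrite mem_cat => /orP[/mapP[l _ ->]//=|/mapP[js _ ->]].
    by have [] := wP js.
  have [f [fg fext fcs]] := gd _ (weak_star_nbhs g cs0).
  have [j [s fE]] := extreme_point_basis eb fext.
  exists (j, s); split=> /=.
    rewrite leqNgt; apply/negP => jN.
    have := fcs (w (j, s)); rewrite mem_cat map_f ?orbT; last first.
      by apply/allpairsP; exists (j, s); rewrite mem_iota jN !inE; case: (s).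
    have ng : (-1) ^+ s *: e j != g by rewrite -fE.
    move=> /(_ isT); rewrite fE => h2; have [_ /(_ ng) h1] := wP (j, s).
    by have := le_lt_trans h1 h2; rewrite ltxx.
  move=> l lL; have := fcs (D l, L.+1%:R^-1).
  rewrite mem_cat; rewrite (map_f (fun l => (D l, L.+1%:R^-1 : R))) ?mem_iota//=.
  by rewrite fE => /(_ isT).
have /choice[sl slP] : forall NL : nat * nat, exists js : nat * bool,
    (NL.1 <= js.1)%N /\ forall l, (l < NL.2)%N ->
      `|(-1) ^+ js.2 * e js.1 (D l) - g (D l)| < NL.2.+1%:R^-1.
  by move=> [N L]; exact: sel.
pose ms := fix ms k := if k is k'.+1 then sl ((ms k').1.+1, k) else sl (N0, 0%N).
have msS k : ((ms k).1 < (ms k.+1).1)%N by have [] := slP ((ms k).1.+1, k.+1).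
exists (fun k => (ms k).1), (fun k => (ms k).2); split=> // [k|].
  elim: k => [|k IH]; first by have [] := slP (N0, 0%N).
  by rewrite (leq_trans IH)// ltnW.
have [e1 _ _] := eb.
apply: (DP (fun k => (-1) ^+ (ms k).2 *: e (ms k).1)) => [k|l].
  by rewrite normrZ normrX normrN1 expr1n mul1r.
apply/cvgrPdistC_le => d d0.
have H k : (l < k)%N ->
    `|(-1) ^+ (ms k).2 * e (ms k).1 (D l) - g (D l)| < k.+1%:R^-1.
  by case: k => // k lk; have [_ /(_ l lk)] := slP ((ms k).1.+1, k.+1).
near=> k; have lk : (l < k)%N by near: k; exact: nbhs_infty_gt.
apply: (le_trans (ltW (H k lk))); apply: ltW.
by near: k; exact: (near_infty_natSinv_lt (PosNum d0)).
Unshelve. all: by end_near. Qed.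

Lemma increasing_subsum_le (m : nat -> nat) (a : ell1 R) N0 n :
  (forall k, (N0 <= m k)%N) -> (forall k, (m k < m k.+1)%N) ->
  \sum_(0 <= k < n) `|a (m k)| <= `|a| - \sum_(0 <= j < N0) `|a j|.
Proof.
move=> mN mS; rewrite lerBrDl.
have H : \sum_(0 <= k < n) `|a (m k)| <= \sum_(N0 <= j < m n) `|a j|.
  elim: n => [|n IH]; first by rewrite big_geq// sumr_ge0.
  rewrite big_nat_recr//= [leRHS](@big_cat_nat _ _ _ (m n))//=; last exact: ltnW.
  rewrite lerD// (big_ltn (mS n)) lerDl sumr_ge0//.
rewrite (le_trans (lerD (lexx _) H))// -big_cat_nat//; exact: ell1_norm_ge.
Qed.

Lemma exists_good_subsequence (alpha : ell1 R) : `|alpha| < rstar X ->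
  exists (e' : nat -> dual X) (m : nat -> nat) (N0 : nat) (ga beta : ell1 R) (g : dual X),
   [/\ ell1_basis e', injective m, forall k, (N0 <= m k)%N, `|alpha| < `|g|
     & [/\ forall U : dual (dual X), series (fun j => ga j * U (e' j)) @ \oo --> (U g : R),
      forall k, beta k = alpha k - ga (m k), `|beta| < \sum_(0 <= j < N0) `|ga j|
      & forall x, (fun k => e' (m k) x) @ \oo --> (g x : R)]].
Proof.
move=> ar.
have [g gd ag] : exists2 g, weak_star_derived (extreme_points (unit_ball (dual X))) g
    & `|alpha| < `|g|.
  apply: contrapT => /forall2NP H; move: ar; rewrite ltNge => /negP; apply.
  (* An empty derived set makes the supremum 0, which cannot exceed [|alpha|]. *)
  rewrite /rstar; set A := (X in sup X); have [->|/set0P A0] := eqVneq A set0.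
    by rewrite sup0.
  apply: ge_sup => // _ [g gd <-]; rewrite leNgt; apply/negP => ag.
  by have [] := H g.
have [a [ga _ _ _]] := basis_expansion eb g.
(* With [d] this third of the gap, one [d] bounds the mass of [g] on the chosen basis vectors and
   one its mass beyond the cutoff: [|beta| <= |alpha| + d < |a| - d <= G]. *)
have d0 : 0 < (`|a| - `|alpha|) / 3 by rewrite divr_gt0// subr_gt0 -ga.
have [N0 /(_ N0 (leqnn N0)) aN] := ell1_tail_small a d0.
have [m [sg [mN mS mg]]] := limit_point_selection gd N0.
have m_inj := injective_of_increasing mS.
(* The sign at index [k] is moved to the basis index [m k], which is consistent as [m] is
   injective. *)
pose sg' j := if pselect (exists k, m k = j) is left H then sg (projT1 (cid H)) else false.
have sg'm k : sg' (m k) = sg k.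
  rewrite /sg'; case: pselect => [H|[]]; last by exists k.
  by case: cid => k' /= /m_inj ->.
have eb' := basis_resign sg'.
have [_ /(_ g)[a' ga' aU'] _] := eb'.
have aa' : `|a'| = `|a| by rewrite -ga' -ga.
(* A cutoff for the expansion in the re-signed basis; [m'] drops the first [N1] terms of [m] and so
   stays beyond it, since [k <= m k]. *)
have [N1 [N1N aN1]] : exists N1, (N0 <= N1)%N /\ `|a'| - \sum_(0 <= j < N1) `|a' j| <= (`|a| - `|alpha|) / 3.
  have [N1 H] := ell1_tail_small a' d0; exists (maxn N0 N1); split; first exact: leq_maxl.
  by apply: H; exact: leq_maxr.
pose m' k := m (N1 + k)%N.
have mge k : (k <= m k)%N by elim: k => // k IH; exact: leq_ltn_trans IH (mS k).
have m'N k : (N1 <= m' k)%N by rewrite (leq_trans _ (mge _))// leq_addr.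
have m'S k : (m' k < m' k.+1)%N by rewrite /m' addnS; exact: mS.
have [n|gm gmE gm_le] := @ell1_exists R (fun k => a' (m' k)) (`|a'| - \sum_(0 <= j < N1) `|a' j|).
  exact: increasing_subsum_le.
exists (fun j => (-1) ^+ sg' j *: e j), m', N1, a', (alpha - gm), g; split=> //.
  exact: injective_of_increasing.
split=> // [k||x]; first by rewrite ell1BE gmE.
  rewrite (le_lt_trans (ler_normB _ _))//; move: gm_le aN1; rewrite aa'.
  by move: d0; lra.
have -> : (fun k => ((-1) ^+ sg' (m' k) *: e (m' k)) x)
    = (fun k => (-1) ^+ sg (k + N1)%N * e (m (k + N1)%N) x).
  by apply/funext => k; rewrite dualZE sg'm /m' addnC.
exact: (@cvg_comp _ _ _ (fun k => (k + N1)%N) (fun k => (-1) ^+ sg k * e (m k) x) _ _ _ (cvg_addnr N1) (mg x)).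
Qed.

End selection.

(** * The copy of [Wspace alpha] *)

Section functionals_on_c.
Context {R : realType}.

Lemma cvgseq_exists (u : nat -> R) (l : R) : u @ \oo --> l ->
  exists z : cvgseq R, forall k, z k = u k.
Proof.
move=> ul; have uc : (u : nat -> R^o) \in @in_cvgseq R.
  by apply/asboolP/cvg_ex; exists l.
by exists (CvgSeq uc).
Qed.

Lemma cvgseq_norm_ge (z : cvgseq R) k : `|z k| <= `|z|.
Proof. exact: (supnorm_ub (cvgseq_bounded z)). Qed.

Lemma cvgseq_norm_le (z : cvgseq R) M : (forall k, `|z k| <= M) -> `|z| <= M.
Proof. by move=> zM; apply: supnorm_le => // ; exists 0%N. Qed.

Lemma cvgseq_eqP (z w : cvgseq R) : (forall k, z k = w k) -> z = w.
Proof. by move=> zw; apply/val_inj/funext. Qed.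

Lemma cvgseqDE (z w : cvgseq R) k : (z + w) k = z k + w k. Proof. by []. Qed.
Lemma cvgseqBE (z w : cvgseq R) k : (z - w) k = z k - w k. Proof. by []. Qed.
Lemma cvgseqZE (t : R) (z : cvgseq R) k : (t *: z) k = t * z k. Proof. by []. Qed.
Lemma cvgseq_sumE n (F : nat -> cvgseq R) k :
  (\sum_(0 <= i < n) F i) k = \sum_(0 <= i < n) F i k.
Proof. by rewrite (big_morph (fun z : cvgseq R => z k) (id1 := 0) (op1 := +%R)). Qed.

(** The dual of [c]: [F z = s * lim z + sum_k c_k z_k], with [c_k] the value at the [k]-th unit
    vector and [s] the defect at the constant sequence 1. Subtracting the limit leaves a null
    sequence, which its truncations approximate in norm. *)
Lemma cvgseq_functional (F : {linear cvgseq R -> R^o}) (M : R) :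
  (forall z, F z <= M * `|z|) ->
  exists (c : ell1 R) (s : R), forall (z : cvgseq R) (l : R), (z : nat -> R) @ \oo --> l ->
    series (fun k => c k * z k) @ \oo --> F z - s * l.
Proof.
move=> FM.
have FaM z : `|F z| <= M * `|z|.
  by rewrite ler_norml FM andbT lerNl -linearN (le_trans (FM _))// normrN.
have /choice[dl dlP] : forall j, exists d : cvgseq R, forall k, d k = (k == j)%:R.
  move=> j; apply: (@cvgseq_exists _ 0); apply: cvg_near_cst; near=> k.
  by rewrite gtn_eqF//; near: k; exact: nbhs_infty_gt.
have [one oneP] : exists d : cvgseq R, forall k, d k = 1.
  by apply: (@cvgseq_exists _ 1); exact: cvg_cst.
have dl_sum (b : nat -> R) n k :
    (\sum_(0 <= j < n) b j *: dl j) k = if (k < n)%N then b k else 0.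
  rewrite cvgseq_sumE; case: ltnP => kn.
    rewrite (bigD1_seq k) ?mem_index_iota ?iota_uniq// cvgseqZE dlP eqxx mulr1.
    rewrite big1 => [|j jk]; first exact: addr0.
    by rewrite cvgseqZE dlP eq_sym (negbTE jk) mulr0.
  rewrite big_nat big1// => j /andP[_ jn].
  by rewrite cvgseqZE dlP gtn_eqF ?mulr0// (leq_trans jn).
have Fsum (b : nat -> R) n :
    F (\sum_(0 <= j < n) b j *: dl j) = \sum_(0 <= j < n) b j * F (dl j).
  by rewrite linear_sum; apply: eq_bigr => j _; rewrite /= linearZ.
have M0 : 0 <= M.
  have := le_trans (normr_ge0 _) (FaM one); rewrite pmulr_lge0//.
  by apply: lt_le_trans (cvgseq_norm_ge one 0%N); rewrite oneP normr1.
have [n|c cE _] := @ell1_exists R (fun k => F (dl k)) M.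
  have -> : \sum_(0 <= k < n) `|F (dl k)|
      = F (\sum_(0 <= j < n) Num.sg (F (dl j)) *: dl j).
    by rewrite Fsum; apply: eq_bigr => k _; rewrite normrEsg.
  rewrite (le_trans (FM _))// ler_piMr//; apply: cvgseq_norm_le => k.
  rewrite dl_sum; case: ifP => _; last by rewrite normr0.
  by rewrite normr_sg; case: (_ != 0).
have [C cC] : exists C : R, series (fun k => c k * 1) @ \oo --> C.
  by exists (limn (series (fun k => c k * 1))); apply: (@is_cvg_ell1_series _ c _ 1) => k; rewrite normr1.
exists c, (F one - C) => z l zl.
have key : series (fun k => c k * (z k - l)) @ \oo --> F z - l * F one.
  apply/cvgrPdist_le => d d0.
  have d1 : 0 < d / (1 + M) by rewrite divr_gt0// ltr_pwDl.
  have /cvgrPdistC_le/(_ _ d1)[N _ zN] := zl.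
  exists N => // n /= Nn.
  have -> : F z - l * F one - series (fun k => c k * (z k - l)) n
      = F (z - l *: one - \sum_(0 <= j < n) (z j - l) *: dl j).
    have -> : series (fun k => c k * (z k - l)) n
        = F (\sum_(0 <= j < n) (z j - l) *: dl j).
      by rewrite Fsum /series/=; apply: eq_bigr => k _; rewrite cE mulrC.
    have -> : l * F one = F (l *: one) by rewrite [RHS]linearZ.
    by rewrite [RHS]linearB [F (z - l *: one)]linearB.
  rewrite (le_trans (FaM _))// (@le_trans _ _ (M * (d / (1 + M))))//; last first.
    by rewrite mulrCA ler_piMr ?(ltW d0)// ler_pdivrMr ?ltr_pwDl// mul1r lerDr.
  rewrite ler_wpM2l//; apply: cvgseq_norm_le => k.
  rewrite cvgseqBE dl_sum cvgseqBE cvgseqZE oneP mulr1; case: ltnP => [_|nk].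
    by rewrite subrr normr0 ltW.
  by rewrite subr0; apply: zN => /=; exact: leq_trans nk.
have : (fun n => series (fun k => c k * (z k - l)) n + l * series (fun k => c k * 1) n)
    @ \oo --> F z - l * F one + l * C.
  by apply: cvgD => //; apply: cvgMl_tmp.
have -> : F z - l * F one + l * C = F z - (F one - C) * l by ring.
suff -> : (fun n => series (fun k => c k * (z k - l)) n + l * series (fun k => c k * 1) n)
    = series (fun k => c k * z k) by [].
apply/funext => n; rewrite /series/= mulr_sumr -big_split/=; apply: eq_bigr => k _; ring.
Unshelve. all: by end_near. Qed.

End functionals_on_c.

(** * The span of the nested systems and its closure *)

Section nested_spaces.
Context {R : realType} {X : completeNormedModType R} (e : nat -> dual X).
Hypothesis eb : ell1_basis e.
Variables (m : nat -> nat) (alpha : ell1 R) (g gal : dual X).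
Hypothesis galE : forall x,
  series (fun k => alpha k * e (m k) x) @ \oo --> (gal x : R).
Hypothesis mg : forall x, (fun k => e (m k) x) @ \oo --> (g x : R).

Variable xs : nat -> nat -> X.
Hypothesis xs_sum : forall n j, \sum_(i < n) `|e j (xs n i)| <= 1.
Hypothesis xs_dual : forall n i k, (i < n)%N -> (k < n)%N ->
  e (m k) (xs n i) = (i == k)%:R.
Hypothesis xs_ker : forall n i, (i < n)%N -> g (xs n i) = gal (xs n i).
Hypothesis xs_nested : forall n i, (i < n)%N ->
  xs n i = xs n.+1 i + e (m n) (xs n i) *: xs n.+1 n.

Definition nested_span : set X :=
  [set y | exists n (c : nat -> R), y = \sum_(i < n) c i *: xs n i].

Lemma nested_spanS n k (c : nat -> R) : exists c' : nat -> R,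
  \sum_(i < n) c i *: xs n i = \sum_(i < n + k) c' i *: xs (n + k) i.
Proof.
elim: k => [|k [c' ->]]; first by exists c; rewrite addn0.
exists (fun i => if i == (n + k)%N then \sum_(i < n + k) c' i * e (m (n + k)%N) (xs (n + k) i)
  else c' i).
rewrite addnS big_ord_recr /= eqxx scaler_suml -big_split /=.
apply: eq_bigr => i _; rewrite (ltn_eqF (ltn_ord i)).
by rewrite {1}(xs_nested (ltn_ord i)) scalerDr scalerA.
Qed.

Lemma nested_span_comb (t : R) u v : nested_span u -> nested_span v ->
  nested_span (t *: u + v).
Proof.
move=> [n [c ->]] [k [d ->]].
have [c' ->] := nested_spanS n k c; have [d' ->] := nested_spanS k n d.
exists (n + k)%N, (fun i => t * c' i + d' i); rewrite [(k + n)%N]addnC.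
rewrite scaler_sumr -big_split; apply: eq_bigr => i _ /=.
by rewrite scalerA scalerDl.
Qed.

Lemma nested_span_xs n i : (i < n)%N -> nested_span (xs n i).
Proof.
move=> iln; exists n, (fun j => (j == i)%:R).
rewrite (bigD1 (Ordinal iln))//= eqxx scale1r big1 ?addr0// => j.
by rewrite -val_eqE /= => /negbTE ->; rewrite scale0r.
Qed.

Lemma nested_span0 : nested_span 0.
Proof. by exists 0%N, (fun=> 0); rewrite big_ord0. Qed.

(** The coefficients of [y] are its values at the [e (m i)], so [xs_sum] bounds all other
    coordinates by them: each system spans a copy of [ell_infty^n]. *)
Lemma nested_span_norm y M : 0 <= M -> nested_span y ->
  (forall k, `|e (m k) y| <= M) -> `|y| <= M.
Proof.
move=> M0 [n [c ->]] yM.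
have cE (i : 'I_n) : e (m i) (\sum_(i < n) c i *: xs n i) = c i.
  rewrite linear_sum (bigD1 i)//= dual_linearZ xs_dual// eqxx mulr1 big1 ?addr0//.
  by move=> j ji; rewrite dual_linearZ xs_dual// (_ : (j == i :> nat) = false) ?mulr0//; apply/negbTE.
apply: (basis_norm_le eb) => // j.
rewrite linear_sum (le_trans (ler_norm_sum _ _ _))//.
rewrite (@le_trans _ _ (\sum_(i < n) M * `|e j (xs n i)|))//.
  apply: ler_sum => i _; rewrite /= dual_linearZ normrM ler_wpM2r//.
  by rewrite -cE yM.
by rewrite -mulr_sumr ler_piMr.
Qed.

Lemma nested_span_ker y : nested_span y -> g y = gal y.
Proof.
move=> [n [c ->]]; rewrite !linear_sum; apply: eq_bigr => i _ /=.
by rewrite !dual_linearZ xs_ker.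
Qed.

Let Y : set X := closure nested_span.

Lemma span_closureP y : Y y <-> forall d, 0 < d -> exists2 w, nested_span w & `|y - w| <= d.
Proof.
split=> [Yy d d0|H].
  have [w [Dw yw]] := Yy _ (nbhsx_ballx y d d0).
  by exists w => //; move: yw; rewrite -ball_normE /ball_/= => /ltW.
move=> B /nbhs_ballP[d /= d0 yB].
have d2 : 0 < d / 2 by rewrite divr_gt0.
have [w Dw yw] := H _ d2; exists w; split => //; apply: yB.
by rewrite -ball_normE /ball_/= (le_lt_trans yw)// ltr_pdivrMr// mulr_natr mulr2n ltrDl.
Qed.

Lemma span_closure_comb (t : R) u v : Y u -> Y v -> Y (t *: u + v).
Proof.
move=> /span_closureP Yu /span_closureP Yv; apply/span_closureP => d d0.
have d1 : 0 < d / 2 / (1 + `|t|) by rewrite !divr_gt0// ltr_pwDl.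
have d2 : 0 < d / 2 by rewrite divr_gt0.
have [u' Du uu'] := Yu _ d1; have [v' Dv vv'] := Yv _ d2.
exists (t *: u' + v'); first exact: nested_span_comb.
rewrite opprD addrACA -scalerBr (le_trans (ler_normD _ _))// [leRHS]splitr lerD//.
rewrite normrZ (le_trans (ler_wpM2l _ uu'))// mulrCA ler_piMr ?(ltW d2)//.
by rewrite ler_pdivrMr ?ltr_pwDl// mul1r lerDr.
Qed.

Lemma span_closure_norm y M : 0 <= M -> Y y ->
  (forall k, `|e (m k) y| <= M) -> `|y| <= M.
Proof.
move=> M0 /span_closureP Yy yM; apply/ler_addgt0Pr => d d0.
have d2 : 0 < d / 2 by rewrite divr_gt0.
have [w Dw yw] := Yy _ d2.
have : `|w| <= M + d / 2.
  apply: nested_span_norm => // [|k]; first by rewrite addr_ge0// ltW.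
  have -> : e (m k) w = e (m k) y - e (m k) (y - w) by rewrite [e _ (y - w)]linearB /= opprB addrC subrK.
  rewrite (le_trans (ler_normB _ _))// lerD//.
  by rewrite (le_trans (basis_val_le eb _ _)).
by have := ler_normD (y - w) w; rewrite subrK; lra.
Qed.

Lemma span_closure_ker y : Y y -> g y = gal y.
Proof.
move=> /span_closureP Yy; apply/eqP; rewrite -subr_eq0 -dualBE -normr_le0.
apply/ler_addgt0Pr => d d0.
have d1 : 0 < d / (1 + `|g - gal|) by rewrite divr_gt0// ltr_pwDl.
have [w Dw yw] := Yy _ d1.
have -> : (g - gal) y = (g - gal) (y - w).
  have Ew : (g - gal) w = 0 by rewrite dualBE (nested_span_ker Dw) subrr.
  by rewrite -[w]scale1r dual_linearBZ Ew mulr0 subr0.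
rewrite add0r (le_trans (le_dual_norm _ _))// (le_trans (ler_wpM2l _ yw))//.
by rewrite mulrCA ler_piMr ?(ltW d0)// ler_pdivrMr ?ltr_pwDl// mul1r lerDr.
Qed.

(* Hahn--Banach on [c]: a functional vanishing on the coordinates of the nested vectors acts on [Wspace alpha] as an [ell1] sequence [d], and testing [d] on the [n]-th system, which is biorthogonal up to its tail, forces [d = 0]. *)
Lemma nested_span_dense (w : cvgseq R) (l c : R) : (w : nat -> R) @ \oo --> l ->
  series (fun k => alpha k * w k) @ \oo --> l -> 0 < c ->
  exists2 y, nested_span y & forall k, `|w k - e (m k) y| <= c.
Proof.
move=> wl wal c0; apply: contrapT => /forall2NP H.
have /choice[Q QP] : forall x : X, exists q : cvgseq R, forall k, q k = e (m k) x.
  by move=> x; exact: cvgseq_exists (@mg x).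
have ns : seminorm (fun z : cvgseq R => `|z|).
  by split=> [u v|t u]; [exact: ler_normD|rewrite normrZ].
have [||_ [y [Dy ->]]|F [F1 F0 Fw]] :=
    hahn_banach_annihilator (D := [set z | exists y, nested_span y /\ z = Q y]) (y := w) (c := c) ns.
- exists 0; split; first exact: nested_span0.
  by apply: cvgseq_eqP => k; rewrite QP linear0.
- move=> t _ _ [u [Du ->]] [v [Dv ->]]; exists (t *: u + v); split.
    exact: nested_span_comb.
  by apply: cvgseq_eqP => k; rewrite cvgseqDE cvgseqZE !QP linearD /= dual_linearZ.
- rewrite leNgt; apply/negP => wy.
  have [|] := H (- y); last apply.
    by apply; rewrite -scaleN1r -[_ *: y]addr0; exact: nested_span_comb Dy nested_span0.
  move=> k; rewrite linearN /= opprK -QP -cvgseqDE.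
  exact: le_trans (cvgseq_norm_ge _ k) (ltW wy).
have F1' z : F z <= 1 * `|z| by rewrite mul1r.
have [b [s bP]] := cvgseq_functional F1'.
(* On [Wspace alpha] the limit term [s * l] equals [s * sum_k alpha k * z k] and is absorbed into
   the sequence. *)
pose d : ell1 R := b + s *: alpha.
have dP (z : cvgseq R) (lz : R) : (z : nat -> R) @ \oo --> lz ->
    series (fun k => alpha k * z k) @ \oo --> lz ->
    series (fun k => d k * z k) @ \oo --> (F z : R).
  move=> zl za.
  have : (fun n => series (fun k => b k * z k) n + s * series (fun k => alpha k * z k) n)
      @ \oo --> F z - s * lz + s * lz.
    by apply: cvgD; [exact: bP|apply: cvgMl_tmp].
  rewrite subrK; suff -> : (fun n => series (fun k => b k * z k) n
      + s * series (fun k => alpha k * z k) n) = series (fun k => d k * z k) by [].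
  apply/funext => n; rewrite /series/= mulr_sumr -big_split/=.
  by apply: eq_bigr => k _; rewrite mulrDl mulrA.
have d0 i : d i = 0.
  apply/eqP; rewrite -normr_le0; apply/ler_addgt0Pr => r r0.
  have [N dN] := ell1_tail_small d r0; pose n := maxn N i.+1.
  have iln : (i < n)%N by exact: leq_maxr.
  have := dP (Q (xs n i)) (g (xs n i)).
  have -> : (Q (xs n i) : nat -> R) = (fun k => e (m k) (xs n i)).
    by apply/funext => k; exact: QP.
  move=> /(_ (@mg _)); rewrite xs_ker// => /(_ (@galE _)).
  rewrite (F0 (Q (xs n i))); last by exists (xs n i); split=> //; exact: nested_span_xs.
  have b1 k : `|e (m k) (xs n i)| <= 1.
    by rewrite (le_trans _ (xs_sum n (m k)))// (bigD1 (Ordinal iln))//= lerDl sumr_ge0.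
  move=> /(ell1_series_tail n b1); rewrite sub0r normrN mulr1 add0r.
  move=> /le_trans/(_ (dN n (leq_maxl _ _))).
  rewrite (big_nat_remove _ iln) big_nat_cond big1 => [|k /andP[/andP[_ kn] ki]].
    by rewrite addr0 xs_dual// eqxx mulr1.
  by rewrite xs_dual// eq_sym (negbTE ki) mulr0.
have := dP w l wl wal; have -> : series (fun k => d k * w k) = cst 0.
  rewrite (_ : (fun k => d k * w k) = (fun=> 0)).
    by apply/funext => n; rewrite /series/= big1.
  by apply/funext => k; rewrite d0 mul0r.
move=> /(@cvg_lim _ (@norm_hausdorff _ R^o)); rewrite lim_cst// => Fw0.
by move: Fw; rewrite -Fw0 leNgt c0.
Qed.

End nested_spaces.

Lemma exists_nested_systems (R : realType) (X : completeNormedModType R)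
    (e : nat -> dual X) (m : nat -> nat) (N0 : nat) (ga alpha beta : ell1 R) (g gal : dual X) :
  ell1_basis e -> injective m -> (forall k, (N0 <= m k)%N) ->
  (forall U : dual (dual X), series (fun j => ga j * U (e j)) @ \oo --> (U g : R)) ->
  (forall U : dual (dual X), series (fun k => alpha k * U (e (m k))) @ \oo --> (U gal : R)) ->
  (forall k, beta k = alpha k - ga (m k)) ->
  `|beta| < \sum_(0 <= j < N0) `|ga j| ->
  exists xs : nat -> nat -> X,
    [/\ forall n j, \sum_(i < n) `|e j (xs n i)| <= 1,
        forall n i k, (i < n)%N -> (k < n)%N -> e (m k) (xs n i) = (i == k)%:R,
        forall n i, (i < n)%N -> g (xs n i) = gal (xs n i)
      & forall n i, (i < n)%N -> xs n i = xs n.+1 i + e (m n) (xs n i) *: xs n.+1 n].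
Proof.
move=> eb m_inj mN0 gE galE betaE betaG; have [e1 _ _] := eb.
have [gbe [gbeE _ gbe_le]] := dual_series beta (fun k => e1 (m k)).
set G := \sum_(0 <= j < N0) `|ga j| in betaG.
have gap0 : 0 < 1 - `|beta| / G.
  have G0 : 0 < G by rewrite (le_lt_trans _ betaG).
  by rewrite subr_gt0 ltr_pdivrMr// mul1r.
pose good n (x : nat -> X) := exists2 kap, kap < 1 - `|beta| / G &
  step_invariant e m N0 ga g gal gbe n kap x.
have /choice[stp stpP] : forall nx : nat * (nat -> X), exists x' : nat -> X,
    good nx.1 nx.2 -> good nx.1.+1 x' /\
    forall i, (i < nx.1)%N -> nx.2 i = x' i + e (m nx.1) (nx.2 i) *: x' nx.1.
  move=> [n x] /=; have [[kap kgap inv]|ng] := pselect (good n x); last by exists x.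
  (* Moving [kap] to the midpoint keeps it strictly below the bound at every step. *)
  have kk : kap < (kap + (1 - `|beta| / G)) / 2 by rewrite ltr_pdivlMr//; lra.
  have [x' inv' rel] :=
    inductive_step eb m_inj mN0 gE galE gbeE gbe_le betaE betaG inv kk kgap.
  exists x' => _; split=> //; exists ((kap + (1 - `|beta| / G)) / 2) => //.
  by rewrite ltr_pdivrMr//; lra.
pose xs := fix xs n := if n is n'.+1 then stp (n', xs n') else fun=> 0.
have xsg n : good n (xs n).
  elim: n => [|n IH]; last by have [] := stpP (n, xs n) IH.
  (* The empty system starts with [kap = 0], admissible because [|beta| < G]. *)
  by exists 0 => //; split=> // j; rewrite big_ord0// ler01.
exists xs; split=> [n|n|n i|n].
- by have [kap _ []] := xsg n.
- by have [kap _ []] := xsg n.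
- have [kap _ [_ _ h _]] := xsg n => iln.
  by apply/eqP; rewrite -subr_eq0 -dualBE h.
- by have [] := stpP (n, xs n) (xsg n).
Qed.

(** On the closed span the coordinates [m k] determine the norm, so nested vectors approximating a
    given [w] are Cauchy and evaluation at the [e (m k)] is onto [Wspace alpha]. The projection
    subtracts from [(e_{m_k}(x))_k] the constant sequence that brings it into [Wspace alpha], and
    lifts the result. *)
Lemma complemented_Wspace (R : realType) (X : completeNormedModType R)
    (e : nat -> dual X) (m : nat -> nat) (alpha : ell1 R) (g gal : dual X)
    (xs : nat -> nat -> X) :
  ell1_basis e -> `|alpha| < 1 ->
  (forall x, series (fun k => alpha k * e (m k) x) @ \oo --> (gal x : R)) ->
  (forall x, (fun k => e (m k) x) @ \oo --> (g x : R)) ->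
  (forall n j, \sum_(i < n) `|e j (xs n i)| <= 1) ->
  (forall n i k, (i < n)%N -> (k < n)%N -> e (m k) (xs n i) = (i == k)%:R) ->
  (forall n i, (i < n)%N -> g (xs n i) = gal (xs n i)) ->
  (forall n i, (i < n)%N -> xs n i = xs n.+1 i + e (m n) (xs n i) *: xs n.+1 n) ->
  [/\ closed_subspace (closure (nested_span xs)),
      linearly_isometric (closure (nested_span xs)) (Wspace alpha)
    & complemented (closure (nested_span xs))].
Proof.
move=> eb alpha1 galE mg xs_sum xs_dual xs_ker xs_nested.
set Y := closure (nested_span xs).
have Y0 : Y 0 by apply: subset_closure; exact: nested_span0.
have Ycomb t u v : Y u -> Y v -> Y (t *: u + v) by exact: span_closure_comb xs_nested _ _ _.
have YB u v : Y u -> Y v -> Y (u - v).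
  by move=> Yu Yv; rewrite addrC -scaleN1r; exact: Ycomb.
have Ynorm y M : 0 <= M -> Y y -> (forall k, `|e (m k) y| <= M) -> `|y| <= M.
  exact: (span_closure_norm eb xs_sum xs_dual).
have Yinj u v : Y u -> Y v -> (forall k, e (m k) u = e (m k) v) -> u = v.
  move=> Yu Yv uv; apply/eqP; rewrite -subr_eq0 -normr_le0; apply: Ynorm => //.
    exact: YB.
  by move=> k; rewrite linearB /= uv subrr normr0.
have Yker y : Y y -> g y = gal y by exact: (span_closure_ker xs_ker).
have Ysurj (w : cvgseq R) (l : R) : (w : nat -> R) @ \oo --> l ->
    series (fun k => alpha k * w k) @ \oo --> l ->
    exists2 y, Y y & forall k, e (m k) y = w k.
  move=> wl wal.
  have /choice[d dP] : forall n, exists y, nested_span xs y /\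
      forall k, `|w k - e (m k) y| <= n.+1%:R^-1.
    move=> n; have n0 : 0 < n.+1%:R^-1 :> R by rewrite invr_gt0.
    have [y Dy yw] := nested_span_dense galE mg xs_sum xs_dual xs_ker xs_nested wl wal n0.
    by exists y.
  have Yd n : Y (d n) by apply: subset_closure; exact: (dP n).1.
  have small (c : R) : 0 < c -> exists N, forall n, (N <= n)%N -> n.+1%:R^-1 <= c.
    move=> c0; have [N _ H] := near_infty_natSinv_lt (PosNum c0).
    by exists N => n /H /ltW.
  have [y dy] : exists y : X, d @ \oo --> y.
    apply: cauchy_limit => c c0.
    have c2 : 0 < c / 2 by rewrite divr_gt0.
    have [N HN] := small _ c2; exists N => n Nn; apply: Ynorm; first exact: ltW.
      exact: YB.
    move=> k; have -> : e (m k) (d n - d N) = (w k - e (m k) (d N)) - (w k - e (m k) (d n)).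
      by rewrite linearB /=; ring.
    rewrite (le_trans (ler_normB _ _))// [leRHS]splitr lerD//.
      by rewrite (le_trans ((dP N).2 k))// HN.
    by rewrite (le_trans ((dP n).2 k))// HN.
  have Yy : Y y.
    apply: (closed_cvg Y _ _ _ dy); first exact: closed_closure.
    by apply: nearW => n; exact: Yd.
  exists y => // k.
  have ek : (fun n => e (m k) (d n)) @ \oo --> (e (m k) y : R).
    by apply: (@cvg_comp _ _ _ d (e (m k) : X -> R^o) _ _ _ dy); exact: (dualP (e (m k))).2.
  apply: (@cvg_unique _ (@norm_hausdorff _ R^o) _ _ _ _ ek).
  apply/cvgrPdist_le => c c0; have [N HN] := small _ c0.
  near=> n; rewrite (le_trans ((dP n).2 k))// HN//.
  by near: n; exact: nbhs_infty_ge.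
split.
- split; last exact: closed_closure.
  split; first by rewrite inE.
  by move=> t u v; rewrite !inE; exact: Ycomb.
- have /choice[Q QP] : forall x : X, exists q : cvgseq R, forall k, q k = e (m k) x.
    by move=> x; exact: cvgseq_exists (mg x).
  have Qfun x : (Q x : nat -> R) = (fun k => e (m k) x) by apply/funext => k; rewrite QP.
  exists Q; split.
  + split.
    * move=> y Yy; rewrite /Wspace /= Qfun.
      rewrite (cvg_lim (@norm_hausdorff _ R^o) (mg y)) Yker//.
      by apply/esym/(cvg_lim (@norm_hausdorff _ R^o)); exact: galE.
    * move=> u v; rewrite !inE => Yu Yv uv; apply: Yinj => // k.
      by rewrite -!QP uv.
    * move=> w ww.
      have wb k : `|w k| <= `|w| by exact: cvgseq_norm_ge.
      have wal : series (fun k => alpha k * w k) @ \oo --> limn w.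
        by rewrite ww; exact: (is_cvg_ell1_series wb).
      have [y Yy yw] := Ysurj w _ (cvgseqP w) wal.
      by exists y => //; apply: cvgseq_eqP => k; rewrite QP.
  + by move=> t u v _ _; apply: cvgseq_eqP => k;
      rewrite cvgseqDE cvgseqZE !QP linearD /= dual_linearZ.
  + move=> y Yy; apply/eqP; rewrite eq_le; apply/andP; split.
      by apply: cvgseq_norm_le => k; rewrite QP; exact: basis_val_le.
    by apply: Ynorm => // k; rewrite -QP; exact: cvgseq_norm_ge.
have a1 (k : nat) : `|1 : R| <= 1 by rewrite normr1.
have [A AP] : exists A : R, series (fun k => alpha k * 1) @ \oo --> A.
  by exists (limn (series (fun k => alpha k * 1))); apply: (@is_cvg_ell1_series _ alpha _ 1) => k; rewrite normr1.
have A1 : 1 - A != 0.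
  have := ell1_series_tail 0 a1 AP; rewrite !big_geq// !subr0 mulr1 => A1.
  by rewrite subr_eq0 gt_eqF// (le_lt_trans (ler_norm _))// (le_lt_trans A1).
(* Subtracting the constant [h x] lowers the limit by [h x] and the series by [h x * A]; this [h]
   solves [g x - h x = gal x - h x * A]. *)
pose h : dual X := (1 - A)^-1 *: (g - gal).
have hE x : h x = (g x - gal x) / (1 - A) by rewrite dualZE dualBE mulrC.
have /choice[P PP] : forall x, exists y, Y y /\ forall k, e (m k) y = e (m k) x - h x.
  move=> x.
  have xl : (fun k => e (m k) x - h x) @ \oo --> (g x - h x : R).
    by apply: cvgB => //; exact: cvg_cst.
  have [w wE] := cvgseq_exists xl.
  have wl : (w : nat -> R) @ \oo --> (g x - h x : R).
    by rewrite (_ : (w : nat -> R) = (fun k => e (m k) x - h x))//; apply/funext.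
  have [y Yy yw] : exists2 y, Y y & forall k, e (m k) y = w k.
    apply: Ysurj wl _.
    have : (fun n => series (fun k => alpha k * e (m k) x) n
        - h x * series (fun k => alpha k * 1) n) @ \oo --> gal x - h x * A.
      by apply: cvgB => //; apply: cvgMl_tmp.
    have -> : gal x - h x * A = g x - h x by rewrite hE; field.
    suff -> : (fun n => series (fun k => alpha k * e (m k) x) n
        - h x * series (fun k => alpha k * 1) n) = series (fun k => alpha k * w k) by [].
    apply/funext => n; rewrite /series/= mulr_sumr -sumrB; apply: eq_bigr => k _.
    by rewrite wE; ring.
  by exists y; split=> // k; rewrite yw wE.
have Pl : linear P.
  move=> t u v; apply: Yinj; [exact: (PP _).1|apply: Ycomb; exact: (PP _).1|].
  move=> k; rewrite (PP _).2 !dual_linearP !(PP _).2; ring.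
pose p : {linear X -> X} := HB.pack P (GRing.isLinear.Build R X X *:%R P Pl).
have PY y : Y y -> P y = y.
  move=> Yy; apply: Yinj => // [|k]; first exact: (PP _).1.
  by rewrite (PP _).2 hE Yker// subrr mul0r subr0.
exists p; split.
- apply/linear_boundedP; near=> r => x.
  apply: (@le_trans _ _ ((1 + `|h|) * `|x|)).
    apply: Ynorm; [by rewrite mulr_ge0// addr_ge0|exact: (PP x).1|move=> k].
    rewrite (PP x).2 (le_trans (ler_normB _ _))// mulrDl mul1r lerD//.
      exact: basis_val_le.
    exact: le_dual_norm.
  by rewrite ler_wpM2r//; near: r; exact: nbhs_pinfty_ge.
- by apply/funext => x /=; rewrite PY//; exact: (PP x).1.
- apply/seteqP; split=> [_ [x _ <-]|y Yy]; first exact: (PP x).1.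
  by exists y => //=; rewrite PY.
Unshelve. all: by end_near. Qed.

Unset Implicit Arguments.

Theorem mainTheorem3 (R : realType) (X : completeNormedModType R)
    (hX : linearly_isometric [set: dual X] [set: ell1 R])
    (alpha : ell1 R) (halpha : `|alpha| < rstar X) :
  exists Y : set X,
    [/\ closed_subspace Y, linearly_isometric Y (Wspace alpha) & complemented Y].
Proof.
have [e0 e0b] := ell1_basis_of_isometry hX.
have [e [m [N0 [ga [beta [g [eb m_inj mN0 ag [gE betaE betaG mg]]]]]]]] :=
  exists_good_subsequence e0b halpha.
have [e1 _ _] := eb.
have [gal [galE _ _]] := dual_series alpha (fun k => e1 (m k)).
(* As a weak-star limit of the [e (m k)], [g] has norm at most 1. *)
have alpha1 : `|alpha| < 1.
  rewrite (lt_le_trans ag)//; apply: dual_norm_le => // x; rewrite mul1r.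
  apply: (cvgr_to_le (cvg_norm (mg x))); apply: nearW => k.
  exact: (basis_val_le eb).
have galE' x : series (fun k => alpha k * e (m k) x) @ \oo --> (gal x : R).
  have [V VE] := exists_bidual_eval x; have := galE V; rewrite VE.
  by under [X in series X]eq_fun do rewrite VE.
have [xs [xs1 xs2 xs3 xs4]] := exists_nested_systems eb m_inj mN0 gE galE betaE betaG.
exists (closure (nested_span xs)).
exact: (complemented_Wspace eb alpha1 galE' mg xs1 xs2 xs3 xs4).
Qed.
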